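(* Let $f:(0,+\infty)\to\mathbb{R}$ be an operator convex function, let $\rho,\sigma$ be quantum states, i.e. density matrices in $\mathbb{M}_n$, and let $V^\downarrow, W^\uparrow$ be $n\times n$ unitary matrices such that $V^{\downarrow *}\rho V^\downarrow=\lambda^\downarrow(\rho)$ and $W^{\uparrow *}\sigma W^\uparrow=\lambda^\uparrow(\sigma)$. Then $$\max_{U\in\mathbb{U}_n}\widehat{S}_f(\rho\|U^*\sigma U)=\widehat{S}_f\big(\lambda^\downarrow(\rho)\,\|\,\lambda^\uparrow(\sigma)\big),$$ and $$\arg\max_{U\in\mathbb{U}_n}\widehat{S}_f(\rho\|U^*\sigma U)=W^\uparrow V^{\downarrow *}.$$
   Context: $\mathbb{M}_n$ is the set of complex $n\times n$ matrices and $\mathbb{U}_n$ the set of $n\times n$ unitary matrices. A quantum state (density matrix) is a positive semidefinite $\rho\in\mathbb{M}_n$ with $\operatorname{Tr}\rho=1$. For positive semidefinite $A\in\mathbb{M}_n$, $\lambda^\downarrow(A)$ (resp. $\lambda^\uparrow(A)$) denotes the diagonal matrix of the eigenvalues of $A$ in nonincreasing (resp. nondecreasing) order. Unitaries $V^\downarrow,W^\uparrow$ as in the claim exist by the spectral theorem. Maximal quantum $f$-divergence: for positive definite $\rho,\sigma\in\mathbb{M}_n$, $$\widehat{S}_f(\rho\|\sigma):=\operatorname{Tr}\left[\sigma f\left(\sigma^{-1/2}\rho\,\sigma^{-1/2}\right)\right],$$ and for general positive semidefinite $\rho,\sigma\in\mathbb{M}_n$, $$\widehat{S}_f(\rho\|\sigma):=\lim_{\epsilon\downarrow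 0}\widehat{S}_f(\rho+\epsilon I\|\sigma+\epsilon I),$$ where $I$ is the identity matrix. An operator convex $f$ on $(0,+\infty)$ has the integral representation $$f(x)=f(1)+f'(1)(x-1)+c(x-1)^2+\int_{[0,+\infty)}\frac{(x-1)^2}{x+s}\,d\lambda(s),$$ with $c\ge 0$ and $\lambda$ a positive measure on $[0,+\infty)$ with $\int_{[0,+\infty)}\frac{1}{1+s}\,d\lambda(s)<+\infty$. In terms of this representation, writing $R=\lambda^\downarrow(\rho)$ and $D=\lambda^\uparrow(\sigma)$, the quantity $\widehat{S}_f(\lambda^\downarrow(\rho)\|\lambda^\uparrow(\sigma))$ denotes $$f(1)+c\left[\operatorname{Tr}(R^2D^{-1})-1\right]+\int_{[0,+\infty)}\operatorname{Tr}\frac{D^{-1}R^2}{D^{-1}R+sI}\,d\lambda(s)-2\int_{[0,+\infty)}\operatorname{Tr}\frac{R}{D^{-1}R+sI}\,d\lambda(s)+\int_{[0,+\infty)}\operatorname{Tr}\frac{D}{D^{-1}R+sI}\,d\lambda(s),$$ where $\frac{A}{B}$ means $AB^{-1}$ for positive definite $B$, and for positive semidefinite $B$ it is understood by replacing $B$ with $B+\epsilon I$ and letting $\epsilon\downarrow 0$. *)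

(* Defs.v *)
From HB Require Import structures.
From mathcomp Require Import all_boot all_order all_algebra.
From mathcomp Require Import all_classical all_reals all_analysis.
From mathcomp Require Import complex.

Set Implicit Arguments.
Unset Strict Implicit.
Unset Printing Implicit Defensive.

Import Order.TTheory GRing.Theory Num.Theory.
Import numFieldNormedType.Exports.

Local Open Scope classical_set_scope.
Local Open Scope ring_scope.
Local Open Scope complex_scope.
Local Open Scope sesquilinear_scope.

Definition psd (R : realType) n (A : 'M[R[i]]_n) : Prop :=
  A \is hermsymmx /\ forall x : 'cV[R[i]]_n, 0 <= (x ^t* *m A *m x) 0 0.

Definition posdef (R : realType) n (A : 'M[R[i]]_n) : Prop :=
  A \is hermsymmx /\
  forall x : 'cV[R[i]]_n, x != 0 -> 0 < (x ^t* *m A *m x) 0 0.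

Definition density (R : realType) n (rho : 'M[R[i]]_n) : Prop :=
  psd rho /\ \tr rho = 1.

(* Functional calculus for Hermitian A, from the library's unitary
   diagonalization; the spectrum is real, so Re loses nothing. *)
Definition mxfun (R : realType) n (f : R -> R) (A : 'M[R[i]]_n) : 'M[R[i]]_n :=
  invmx (spectralmx A)
  *m diag_mx (map_mx (fun z => (f (complex.Re z))%:C) (spectral_diag A))
  *m spectralmx A.

(* f stands for a function on (0, +oo): only its values there matter. *)
Definition operator_convex (R : realType) (f : R -> R) : Prop :=
  forall (m : nat) (A B : 'M[R[i]]_m) (t : R),
    posdef A -> posdef B -> 0 <= t <= 1 ->
    psd (t%:C *: mxfun f A + (1 - t)%:C *: mxfun f B
         - mxfun f (t%:C *: A + (1 - t)%:C *: B)).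

(* Eigenvalues of a Hermitian matrix, with multiplicity. *)
Definition eigs (R : realType) n (A : 'M[R[i]]_n) : seq R :=
  [seq complex.Re (spectral_diag A 0 i) | i <- enum 'I_n].

Definition eig_down (R : realType) n (A : 'M[R[i]]_n) : 'M[R[i]]_n :=
  diag_mx (\row_(i < n) ((sort >=%R (eigs A))`_i)%:C).

Definition eig_up (R : realType) n (A : 'M[R[i]]_n) : 'M[R[i]]_n :=
  diag_mx (\row_(i < n) ((sort <=%R (eigs A))`_i)%:C).

Definition addeps (R : realType) n (A : 'M[R[i]]_n) (e : R) : 'M[R[i]]_n :=
  A + e%:C%:M.

(* Real-valued trace: all the traces below are those of a product of two
   Hermitian matrices, hence real. *)
Definition rtr (R : realType) n (A : 'M[R[i]]_n) : R := complex.Re (\tr A).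

Definition maxdiv_pd (R : realType) n (f : R -> R) (rho sigma : 'M[R[i]]_n)
    : R :=
  let s := mxfun (fun x => (Num.sqrt x)^-1) sigma in
  rtr (sigma *m mxfun f (s *m rho *m s)).

Definition maxdiv (R : realType) n (f : R -> R) (rho sigma : 'M[R[i]]_n)
    : \bar R :=
  lim ((maxdiv_pd f (addeps rho e) (addeps sigma e))%:E @[e --> 0^'+]).

Definition opconv_repr (R : realType) (f : R -> R) (c : R)
    (lam : {measure set (measurableTypeR R) -> \bar R}) : Prop :=
  [/\ 0 <= c,
      (\int[lam]_(s in `[0%R, +oo[) ((1 + s)^-1)%:E < +oo)%E
    & forall x : R, 0 < x ->
      (f x)%:E = ((f 1 + derive1 f 1 * (x - 1) + c * (x - 1) ^+ 2)%:E
        + \int[lam]_(s in `[0%R, +oo[) ((x - 1) ^+ 2 / (x + s))%:E)%E].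

(* Tr (A / B) for A and B that may involve D^-1: the regularization
   parameter e is added to D in D^-1 as well as to the denominator B. *)
Definition tr_frac (R : realType) n (A B : R -> 'M[R[i]]_n) : \bar R :=
  lim ((rtr (A e *m invmx (addeps (B e) e)))%:E @[e --> 0^'+]).

(* The value denoted by maxdiv on the ordered spectra, read off the integral
   representation of f. The first and third integrals may be +oo, the second
   is finite on pairs of ordered spectra of density matrices. When c = 0 the
   convention 0 * +oo = 0 drops the second term, as it should. *)
Definition maxdiv_diag (R : realType) n (f : R -> R) (c : R)
    (lam : {measure set (measurableTypeR R) -> \bar R})
    (Rm D : 'M[R[i]]_n) : \bar R :=
  let Dinv e := invmx (addeps D e) in
  let den (s : R) e := addeps (Dinv e *m Rm) s in
  ((f 1)%:E
   + c%:E * (tr_frac (fun=> Rm *m Rm) (fun=> D) - 1)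
   + \int[lam]_(s in `[0%R, +oo[)
       tr_frac (fun e => Dinv e *m (Rm *m Rm)) (den s)
   - 2%:E * \int[lam]_(s in `[0%R, +oo[) tr_frac (fun=> Rm) (den s)
   + \int[lam]_(s in `[0%R, +oo[) tr_frac (fun=> D) (den s))%E.

Definition is_max (R : realType) (T : Type) (A : set T) (F : T -> \bar R)
    (m : \bar R) : Prop :=
  (exists2 x, A x & F x = m) /\ forall x, A x -> (F x <= m)%E.

Definition argmax (R : realType) (T : Type) (A : set T) (F : T -> \bar R)
    : set T :=
  [set x | A x /\ forall y, A y -> (F y <= F x)%E].

(* Main.v *)
(* Write sigma' = U* sigma U and Delta = rho - sigma'. Through the integral
   representation of f, the divergence of the regularized pair is, up to a term
   that does not depend on U, the sum of c Tr (Delta sigma'^-1 Delta) and of the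
   integral over s of Tr (Delta M^-1 Delta), M = rho + s sigma'. The shift of both
   states by epsilon adds a multiple of the identity to sigma' and M, so these
   traces increase as epsilon decreases and the limit exists. Expanding Delta
   around M leaves only Tr (sigma' M^-1 sigma') dependent on U, and for s > 0
   (s sigma') M^-1 (s sigma') = s sigma' - (rho^-1 + (s sigma')^-1)^-1. With A and
   B the two inverses, the eigenvalues of A + B majorize the sums of the
   decreasing eigenvalues of A and the increasing ones of B (Lidskii), so convexity
   of 1/x bounds Tr (A + B)^-1 below by its value on commuting, oppositely ordered
   matrices; the case s = 0 and the c-term are the same argument for x^2 (von
   Neumann's trace inequality). All bounds are attained when U = W V*, and the
   commuting value converges to the stated formula by monotone convergence. *)

Require Import Defs.
From mathcomp Require Import all_boot all_order all_algebra.
From mathcomp Require Import all_classical all_reals all_analysis.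
From mathcomp Require Import complex.
From mathcomp Require Import perm measurable_realfun ring lra.
Import Order.TTheory GRing.Theory Num.Theory.
Import numFieldNormedType.Exports.
Local Open Scope classical_set_scope.
Local Open Scope ring_scope.
Local Open Scope complex_scope.
Local Open Scope sesquilinear_scope.

Set Implicit Arguments.
Unset Strict Implicit.
Unset Printing Implicit Defensive.

(** * Unitarily diagonalized Hermitian matrices *)

(** The eigenvectors are the columns of [T ^t*], the convention of [spectralmx]. For unitary [T] the
    functional calculus acts pointwise on [a], and conjugation by a unitary only multiplies [T] on
    the right. *)
Definition udiag (R : realType) n (T : 'M[R[i]]_n) (a : 'I_n -> R) : 'M[R[i]]_n :=
  T ^t* *m diag_mx (\row_i (a i)%:C) *m T.

Lemma unitarymxVl (R : realType) n (T : 'M[R[i]]_n) :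
  T \is unitarymx -> T ^t* *m T = 1%:M.
Proof. by move=> uT; rewrite -invmx_unitary // mulVmx // unitarymx_unit. Qed.

Lemma unitarymx1 (R : realType) n : (1%:M : 'M[R[i]]_n) \is unitarymx.
Proof. by apply/unitarymxP; rewrite trmx1 map_mx1 mulmx1. Qed.

Lemma unitarymxC (R : realType) n (V : 'M[R[i]]_n) :
  V \is unitarymx -> V ^t* \is unitarymx.
Proof. by rewrite trmxC_unitary. Qed.

Lemma trmxC_mul (R : realType) m n p (A : 'M[R[i]]_(m, n)) (B : 'M[R[i]]_(n, p)) :
  (A *m B) ^t* = B ^t* *m A ^t*.
Proof. by rewrite trmx_mul map_mxM. Qed.

Lemma hermsymmxE (R : realType) n (A : 'M[R[i]]_n) :
  (A \is hermsymmx) = (A == A ^t*).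
Proof. by rewrite is_hermitianmxE expr0 scale1r. Qed.

Lemma hermsymmxP (R : realType) n (A : 'M[R[i]]_n) :
  A \is hermsymmx -> A ^t* = A.
Proof. by rewrite hermsymmxE => /eqP. Qed.

Lemma eq_udiag (R : realType) n (T : 'M[R[i]]_n) (a b : 'I_n -> R) :
  a =1 b -> udiag T a = udiag T b.
Proof. by move=> /funext ->. Qed.

Lemma udiagD (R : realType) n (T : 'M[R[i]]_n) (a b : 'I_n -> R) :
  udiag T a + udiag T b = udiag T (fun i => a i + b i).
Proof.
rewrite /udiag -mulmxDl -mulmxDr -raddfD.
suff -> : \row_i (a i)%:C + \row_i (b i)%:C = \row_i (a i + b i)%:C by [].
by apply/rowP => i; rewrite !mxE rmorphD.
Qed.

Lemma udiagZ (R : realType) n (T : 'M[R[i]]_n) (c : R) (a : 'I_n -> R) :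
  c%:C *: udiag T a = udiag T (fun i => c * a i).
Proof.
rewrite /udiag scalemxAl scalemxAr -linearZ.
suff -> : c%:C *: \row_i (a i)%:C = \row_i (c * a i)%:C by [].
by apply/rowP => i; rewrite !mxE rmorphM.
Qed.

Lemma udiagN (R : realType) n (T : 'M[R[i]]_n) (a : 'I_n -> R) :
  - udiag T a = udiag T (fun i => - a i).
Proof.
have -> : - udiag T a = (-1)%:C *: udiag T a by rewrite rmorphN1 scaleN1r.
by rewrite udiagZ; apply: eq_udiag => i; rewrite mulN1r.
Qed.

Lemma udiagM (R : realType) n (T : 'M[R[i]]_n) (a b : 'I_n -> R) :
  T \is unitarymx ->
  udiag T a *m udiag T b = udiag T (fun i => a i * b i).
Proof.
move=> /unitarymxP uT; rewrite /udiag !mulmxA -(mulmxA _ T) uT mulmx1.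
rewrite -(mulmxA _ (diag_mx _) (diag_mx _)) mulmx_diag.
suff -> : \row_i ((\row_i (a i)%:C) 0 i * (\row_i (b i)%:C) 0 i) =
  \row_i (a i * b i)%:C by [].
by apply/rowP => i; rewrite !mxE rmorphM.
Qed.

Lemma udiag_scalar (R : realType) n (T : 'M[R[i]]_n) (c : R) :
  T \is unitarymx -> udiag T (fun=> c) = (c%:C)%:M.
Proof.
move=> uT; rewrite /udiag.
have -> : \row_(i < n) c%:C = const_mx c%:C by apply/rowP => i; rewrite !mxE.
by rewrite diag_const_mx mul_mx_scalar -scalemxAl unitarymxVl // scalemx1.
Qed.

Lemma udiagV (R : realType) n (T : 'M[R[i]]_n) (a : 'I_n -> R) :
  T \is unitarymx -> (forall i, a i != 0) ->
  (udiag T a \in unitmx) /\ invmx (udiag T a) = udiag T (fun i => (a i)^-1).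
Proof.
move=> uT a0.
have aV : udiag T a *m udiag T (fun i => (a i)^-1) = 1%:M.
  rewrite udiagM // -(udiag_scalar 1 uT).
  by apply: eq_udiag => i; rewrite divff.
have [ua _] := mulmx1_unit aV; split=> //.
by rewrite -[RHS]mul1mx -(mulVmx ua) -mulmxA aV mulmx1.
Qed.

Lemma udiag_herm (R : realType) n (T : 'M[R[i]]_n) (a : 'I_n -> R) :
  udiag T a \is hermsymmx.
Proof.
rewrite hermsymmxE /udiag !trmxC_mul trmxCK mulmxA tr_diag_mx map_diag_mx.
suff -> : map_mx (@conjc R) (\row_i (a i)%:C) = \row_i (a i)%:C by [].
by apply/rowP => i; rewrite !mxE; apply: conjc_real.
Qed.

Lemma udiag_adj (R : realType) n (T U : 'M[R[i]]_n) (a : 'I_n -> R) :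
  U ^t* *m udiag T a *m U = udiag (T *m U) a.
Proof. by rewrite /udiag trmxC_mul !mulmxA. Qed.

Lemma udiag_form (R : realType) n (T : 'M[R[i]]_n) (a : 'I_n -> R) (v : 'cV_n) :
  (v ^t* *m udiag T a *m v) 0 0
    = \sum_i (a i)%:C * `|(T *m v) i 0| ^+ 2.
Proof.
rewrite /udiag !mulmxA -trmxC_mul -mulmxA mxE; apply: eq_bigr => i _.
rewrite mul_mx_diag !mxE sqr_normc [in RHS]mulrC -mulrA mulrC.
by rewrite [in RHS]mulrC mulrA mulrAC [_^*%C * _]mulrC.
Qed.

(** * Real traces, and sorting of a spectrum *)

Lemma rtrD (R : realType) n (A B : 'M[R[i]]_n) : rtr (A + B) = rtr A + rtr B.
Proof. by rewrite /rtr mxtraceD raddfD. Qed.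

Lemma rtrN (R : realType) n (A : 'M[R[i]]_n) : rtr (- A) = - rtr A.
Proof. by rewrite /rtr !raddfN. Qed.

Lemma rtrB (R : realType) n (A B : 'M[R[i]]_n) : rtr (A - B) = rtr A - rtr B.
Proof. by rewrite rtrD rtrN. Qed.

Lemma ReM_real (R : realType) (z : R[i]) (x : R) :
  complex.Re (z * x%:C) = complex.Re z * x.
Proof. by case: z => u v; simpc. Qed.

Lemma rtrZ (R : realType) n (c : R) (A : 'M[R[i]]_n) :
  rtr (c%:C *: A) = c * rtr A.
Proof. by rewrite /rtr mxtraceZ mulrC ReM_real mulrC. Qed.

Lemma rtrC (R : realType) n (A B : 'M[R[i]]_n) : rtr (A *m B) = rtr (B *m A).
Proof. by rewrite /rtr mxtrace_mulC. Qed.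

Lemma Re_sum (R : realType) (I : finType) (F : I -> R[i]) :
  complex.Re (\sum_i F i) = \sum_i complex.Re (F i).
Proof. exact: raddf_sum. Qed.

Lemma rtr_mul_udiag (R : realType) n (A T : 'M[R[i]]_n) (a : 'I_n -> R) :
  rtr (A *m udiag T a) = \sum_i complex.Re ((T *m A *m T ^t*) i i) * a i.
Proof.
rewrite /udiag !mulmxA rtrC !mulmxA /rtr /mxtrace Re_sum; apply: eq_bigr => i _.
by rewrite mul_mx_diag !mxE ReM_real.
Qed.

Lemma rtr_udiag (R : realType) n (T : 'M[R[i]]_n) (a : 'I_n -> R) :
  T \is unitarymx -> rtr (udiag T a) = \sum_i a i.
Proof.
move=> /[dup] uT /unitarymxP uT1; rewrite -[udiag T a]mul1mx rtr_mul_udiag.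
by apply: eq_bigr => i _; rewrite mulmx1 uT1 mxE eqxx mul1r.
Qed.

Lemma herm_udiag (R : realType) n (A : 'M[R[i]]_n) : A \is hermsymmx ->
  A = udiag (spectralmx A) (fun i => complex.Re (spectral_diag A 0 i)).
Proof.
move=> hA; have /orthomx_spectralP {1}-> := hermitian_normalmx hA.
rewrite (invmx_unitary (spectral_unitarymx A)) /udiag.
suff <- : spectral_diag A = \row_i (complex.Re (spectral_diag A 0 i))%:C by [].
apply/rowP => i; rewrite !mxE RRe_real //.
by have /mxOverP := hermitian_spectral_diag_real hA; apply.
Qed.

Lemma sorting_perm (R : realType) n (a : 'I_n -> R) :
  exists s : {perm 'I_n}, forall i j : 'I_n, (i <= j)%N -> a (s j) <= a (s i).
Proof.
pose t := [tuple a i | i < n].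
have sz : size (sort >=%R t) = n by rewrite size_sort size_tuple.
have : perm_eq (sort >=%R t) t by rewrite perm_sort.
move=> /tuple_permP [s es].
exists s => i j ij.
have E (k : 'I_n) : a (s k) = (sort >=%R t)`_k.
  rewrite [sort _ _]es (nth_map k) ?size_enum_ord //.
  by rewrite tnth_mktuple nth_ord_enum.
rewrite !E.
have tr : transitive (>=%R : rel R) by move=> x y z yx /le_trans; apply.
have rf : reflexive (>=%R : rel R) by move=> x /=.
have tot : total (>=%R : rel R) by move=> x y; rewrite /= le_total.
apply: (sorted_leq_nth tr rf 0 (sort_sorted tot t)) => //; rewrite inE sz //.
Qed.

Lemma udiag_perm (R : realType) n (T : 'M[R[i]]_n) (a : 'I_n -> R) (s : {perm 'I_n}) :
  udiag T a = udiag (row_perm s T) (a \o s).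
Proof.
apply/matrixP => i j; rewrite /udiag !mul_mx_diag !mxE.
by rewrite (reindex_perm s); apply: eq_bigr => k _; rewrite !mxE.
Qed.

Lemma row_perm_unitary (R : realType) n (T : 'M[R[i]]_n) (s : {perm 'I_n}) :
  T \is unitarymx -> row_perm s T \is unitarymx.
Proof.
move=> uT; rewrite row_permE; apply: (fun p => mul_unitarymx p uT); apply/unitarymxP.
apply/matrixP => i j; rewrite !mxE (bigD1 (s i)) //= big1 => [|k ki].
  rewrite !mxE eqxx mul1r addr0 (inj_eq perm_inj) [j == i]eq_sym.
  exact: conjc_nat.
by rewrite !mxE [s i == k]eq_sym (negPf ki) mul0r.
Qed.

Lemma herm_udiag_sorted (R : realType) n (A : 'M[R[i]]_n) : A \is hermsymmx ->
  exists T a, [/\ T \is unitarymx, A = udiag T a &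
    forall i j : 'I_n, (i <= j)%N -> a j <= a i].
Proof.
move=> /herm_udiag; set a := fun i => _; have [s sP] := sorting_perm a.
rewrite (udiag_perm _ _ s) => AE; do 2 eexists; split; [|exact: AE|exact: sP].
exact/row_perm_unitary/spectral_unitarymx.
Qed.

(** * Weyl's monotonicity and majorization *)

Lemma udiag_form1 (R : realType) n (T : 'M[R[i]]_n) (v : 'cV_n) :
  T \is unitarymx ->
  (v ^t* *m v) 0 0 = \sum_i `|(T *m v) i 0| ^+ 2.
Proof.
move=> uT; have := udiag_form T (fun=> 1) v.
rewrite udiag_scalar // mulmx1 => ->.
by apply: eq_bigr => i _; rewrite rmorph1 mul1r.
Qed.

Lemma cformv_gt0 (R : realType) n (v : 'cV[R[i]]_n) :
  v != 0 -> 0 < (v ^t* *m v) 0 0.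
Proof.
move=> v0; rewrite (udiag_form1 _ (unitarymx1 R n)).
rewrite mul1mx lt_neqAle sumr_ge0 ?andbT => [|i _]; last exact: exprn_ge0.
apply: contra_neq v0 => /esym/eqP; rewrite psumr_eq0 => [/allP z|i _].
  apply/colP => i; have := z i; rewrite mem_index_enum => /(_ isT).
  by rewrite /= expf_eq0 /= normr_eq0 mxE => /eqP.
exact: exprn_ge0.
Qed.

(* Weyl monotonicity: a nonzero vector in the intersection of the span of the
   first [k+1] eigenvectors of the smaller matrix with that of the eigenvectors
   of index at least [k] of the larger one separates the two forms. *)
Lemma weyl_le (R : realType) n (S T : 'M[R[i]]_n) (a b : 'I_n -> R) :
  S \is unitarymx -> T \is unitarymx ->
  (forall i j : 'I_n, (i <= j)%N -> a j <= a i) ->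
  (forall i j : 'I_n, (i <= j)%N -> b j <= b i) ->
  (forall v : 'cV_n,
    (v ^t* *m udiag S a *m v) 0 0 <= (v ^t* *m udiag T b *m v) 0 0) ->
  forall k, a k <= b k.
Proof.
move=> uS uT a_dec b_dec le_form k.
pose G := T *m S ^t*.
(* Rows of index less than [k] make the corresponding entries of [T *m v] vanish, rows of index
   greater than [k] those of [u = S *m v]. The zero row [k] makes [N] singular, so these [n - 1]
   conditions have a nonzero solution. *)
pose N : 'M[R[i]]_n := \matrix_(i, j)
  if (i < k)%N then G i j else if i == k then 0 else (i == j)%:R.
have /eqP/det0P [w w0 wN] : \det N^T = 0.
  rewrite det_tr (expand_det_row _ k) big1 // => j _.
  by rewrite mxE ltnn eqxx mul0r.
pose u : 'cV_n := w^T.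
have u0 : u != 0 by rewrite -(inj_eq trmx_inj) trmxK trmx0.
have Nu i : (N *m u) i 0 = 0 by rewrite -(trmxK (N *m u)) trmx_mul trmxK wN !mxE.
pose v := S ^t* *m u.
have Sv : S *m v = u by rewrite mulmxA (unitarymxP uS) mul1mx.
have u_hi (i : 'I_n) : (k < i)%N -> u i 0 = 0.
  move=> ki; have := Nu i; rewrite mxE (bigD1 i) //= big1 => [|j ji].
    by rewrite mxE ltnNge (ltnW ki) /= -val_eqE gtn_eqF //= eqxx mul1r addr0.
  rewrite mxE ltnNge (ltnW ki) /= -val_eqE gtn_eqF //= eq_sym (negPf ji).
  by rewrite mul0r.
have Tv_lo (i : 'I_n) : (i < k)%N -> (T *m v) i 0 = 0.
  move=> ik; rewrite /v mulmxA -/G -(Nu i) !mxE.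
  by apply: eq_bigr => j _; rewrite [in RHS]mxE ik.
have v0 : v != 0.
  by apply: contra_neq u0 => v0; rewrite -Sv v0 mulmx0.
have vv := cformv_gt0 v0.
have loS : (a k)%:C * (v ^t* *m v) 0 0 <= (v ^t* *m udiag S a *m v) 0 0.
  rewrite udiag_form (udiag_form1 _ uS) mulr_sumr ler_sum // => i _.
  rewrite Sv; have [ki|ik] := ltnP k i; first by rewrite u_hi // normr0 expr0n !mulr0.
  by rewrite ler_wpM2r ?exprn_ge0 // lecR a_dec.
have hiT : (v ^t* *m udiag T b *m v) 0 0 <= (b k)%:C * (v ^t* *m v) 0 0.
  rewrite udiag_form (udiag_form1 _ uT) mulr_sumr ler_sum // => i _.
  have [ik|ki] := ltnP i k; first by rewrite Tv_lo // normr0 expr0n !mulr0.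
  by rewrite ler_wpM2r ?exprn_ge0 // lecR b_dec.
by have := le_trans loS (le_trans (le_form v) hiT); rewrite ler_pM2r // lecR.
Qed.

Lemma formD (R : realType) n (A B : 'M[R[i]]_n) (v : 'cV_n) :
  (v ^t* *m (A + B) *m v) 0 0 = (v ^t* *m A *m v) 0 0 + (v ^t* *m B *m v) 0 0.
Proof. by rewrite mulmxDr mulmxDl mxE. Qed.

Lemma udiag_form_ge0 (R : realType) n (T : 'M[R[i]]_n) (a : 'I_n -> R) (v : 'cV_n) :
  (forall i, 0 <= a i) -> 0 <= (v ^t* *m udiag T a *m v) 0 0.
Proof.
move=> a0; rewrite udiag_form sumr_ge0 // => i _.
by rewrite mulr_ge0 ?exprn_ge0 // ler0c.
Qed.

Lemma hermD (R : realType) n (A B : 'M[R[i]]_n) :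
  A \is hermsymmx -> B \is hermsymmx -> A + B \is hermsymmx.
Proof.
move=> hA hB; rewrite hermsymmxE linearD map_mxD.
by rewrite (hermsymmxP hA) (hermsymmxP hB).
Qed.

(* Li and Mathias: with [H := (t - B) + (C - t)_+], Weyl's monotonicity bounds
   the eigenvalues of [A <= H] and of [t - B <= H], and the trace of
   [H - (t - B)] is the right-hand side. *)
Lemma sum_hinge_le (R : realType) n (S T U : 'M[R[i]]_n) (a b c : 'I_n -> R)
    (t : R) :
  S \is unitarymx -> T \is unitarymx -> U \is unitarymx ->
  (forall i j : 'I_n, (i <= j)%N -> a j <= a i) ->
  (forall i j : 'I_n, (i <= j)%N -> b i <= b j) ->
  udiag S a + udiag T b = udiag U c ->
  \sum_i Num.max (a i + b i - t) 0 <= \sum_i Num.max (c i - t) 0.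
Proof.
move=> uS uT uU a_dec b_inc abc.
pose p i := Num.max (c i - t) 0.
pose L := udiag T (fun i => t - b i).
have p0 i : 0 <= p i by rewrite le_max lexx orbT.
have [X [h [uX hX h_dec]]] :=
  herm_udiag_sorted (hermD (udiag_herm T (fun i => t - b i)) (udiag_herm U p)).
have le1 k : a k <= h k.
  apply: (weyl_le uS uX a_dec h_dec) => v.
  (* The excess of [H] over [A] is [(C - t)_+ - (C - t)], which is positive semidefinite because a
     positive part dominates its argument. *)
  have -> : udiag X h = udiag S a + udiag U (fun i => p i - (c i - t)).
    have -> : udiag S a = udiag U c - udiag T b by rewrite -abc addrK.
    have -> : udiag U (fun i => p i - (c i - t)) =
              udiag U p - udiag U c + (t%:C)%:M.
      rewrite -(udiag_scalar t uU) udiagN !udiagD.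
      by apply: eq_udiag => i /=; rewrite opprB addrA addrAC.
    rewrite -hX; have <- : (t%:C)%:M - udiag T b = udiag T (fun i => t - b i).
      by rewrite -(udiag_scalar t uT) udiagN udiagD.
    move: (udiag U p) (udiag U c) (udiag T b) (_%:M) => P C B t'.
    by apply/matrixP => i j; rewrite !mxE; ring.
  rewrite formD lerDl; apply: udiag_form_ge0 => i.
  by rewrite subr_ge0 le_max lexx.
have le2 k : t - b k <= h k.
  have tb_dec (i j : 'I_n) : (i <= j)%N -> t - b j <= t - b i.
    by move=> ij; rewrite lerD2l lerN2 b_inc.
  apply: (weyl_le uT uX tb_dec h_dec) => v.
  by rewrite -hX formD lerDl; exact: udiag_form_ge0.
have -> : \sum_i Num.max (c i - t) 0 = \sum_i (h i - (t - b i)).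
  rewrite sumrB -(rtr_udiag h uX) -hX rtrD !rtr_udiag //.
  by rewrite addrAC subrr add0r.
apply: ler_sum => i _; rewrite ge_max subr_ge0 le2 andbT.
by have := le1 i; lra.
Qed.

(** Summation by parts: each decrease of the weight multiplies a nonnegative prefix sum, and the
    boundary term vanishes with the total. *)
Lemma sum_antitone_ge0 (R : realType) n (w x : 'I_n -> R) :
  (forall i j : 'I_n, (i <= j)%N -> w j <= w i) ->
  (forall k, 0 <= \sum_(i < n | (i < k)%N) x i) -> \sum_i x i = 0 ->
  0 <= \sum_i w i * x i.
Proof.
move=> w_dec X0 Xn.
case: n => [|n] in w x w_dec X0 Xn *; first by rewrite big_ord0.
(* The lower bound carried along is the last weight times the prefix sum. Passing to the next
   weight, which is no larger, can only lower it, and at [k = n] it is zero. *)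
suff H k : (k <= n)%N ->
    w (inord k) * (\sum_(i < n.+1 | (i < k.+1)%N) x i)
      <= \sum_(i < n.+1 | (i < k.+1)%N) w i * x i.
  have allE (F : 'I_n.+1 -> R) : \sum_(i < n.+1 | (i < n.+1)%N) F i = \sum_i F i.
    by apply: eq_bigl => i; rewrite ltn_ord.
  by have := H n (leqnn n); rewrite !allE Xn mulr0.
elim: k => [_|k IH kn].
  rewrite (big_pred1 (inord 0)) ?(big_pred1 (inord 0)) // => i;
  by rewrite ltnS leqn0 /= -val_eqE /= inordK.
have split (F : 'I_n.+1 -> R) : \sum_(i < n.+1 | (i < k.+2)%N) F i =
    \sum_(i < n.+1 | (i < k.+1)%N) F i + F (inord k.+1).
  rewrite (bigD1 (inord k.+1)) /= ?inordK //= addrC; congr (_ + _).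
  apply: eq_bigl => i; rewrite -val_eqE /= inordK // ltnS [RHS]ltn_neqAle.
  by rewrite andbC.
rewrite !split mulrDr lerD2r; apply: le_trans (IH (ltnW kn)).
by rewrite ler_wpM2r // w_dec // !inordK // ltnW.
Qed.

(* The Hardy-Littlewood-Polya inequality; majorization of [m] by [c] enters
   through the hinge functions. *)
Lemma hlp_hinge (R : realType) n (D : pred R) (g g' : R -> R) (m c : 'I_n -> R) :
  {in D &, forall x y, g x + g' x * (y - x) <= g y} ->
  (forall i, D (m i)) -> (forall i, D (c i)) ->
  (forall t, \sum_i Num.max (m i - t) 0 <= \sum_i Num.max (c i - t) 0) ->
  \sum_i m i = \sum_i c i ->
  \sum_i g (m i) <= \sum_i g (c i).
Proof.
move=> gP + +; have [s sP] := sorting_perm m; have [r rP] := sorting_perm c.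
rewrite (reindex_perm s) [X in _ -> _ -> _ -> _ = X -> _](reindex_perm r) /=.
rewrite [X in _ -> _ -> _ -> _ -> X <= _](reindex_perm s).
rewrite [X in _ -> _ -> _ -> _ -> _ <= X](reindex_perm r) /=.
move=> Dm Dc hinge mc.
have {}hinge t : \sum_i Num.max (m (s i) - t) 0 <= \sum_i Num.max (c (r i) - t) 0.
  have := hinge t; rewrite (reindex_perm s) /= => /le_trans; apply.
  by rewrite (reindex_perm r).
rewrite -subr_ge0 -sumrB.
(* The tangent inequality at each [m (s i)] leaves a sum with weights [g'] that decrease along the
   sorted [m], so summation by parts applies. *)
apply: (@le_trans _ _ (\sum_i g' (m (s i)) * (c (r i) - m (s i)))); last first.
  by apply: ler_sum => i _; rewrite lerBrDl; apply: gP; [exact: Dm|exact: Dc].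
apply: sum_antitone_ge0 => [i j ij|k|]; last first.
- by rewrite sumrB mc subrr.
- case: k => [|k]; first by rewrite big_pred0.
  have [nk|kn] := leqP n k.+1.
    rewrite (eq_bigl predT) => [|i]; last by rewrite (leq_trans (ltn_ord i)).
    by rewrite sumrB mc subrr.
  (* [t] is the smallest of the [k + 1] largest values of [c]. At this threshold the hinge sum of
     [c] equals its prefix sum, while the prefix sum of [m - t] never exceeds the hinge sum of
     [m]. *)
  have kn' := ltnW kn; pose t := c (r (Ordinal kn')).
  have -> : \sum_(i < n | (i < k.+1)%N) (c (r i) - m (s i)) =
            \sum_(i < n | (i < k.+1)%N) (c (r i) - t)
            - \sum_(i < n | (i < k.+1)%N) (m (s i) - t).
    by rewrite -sumrB; apply: eq_bigr => i _; ring.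
  rewrite subr_ge0.
  have -> : \sum_(i < n | (i < k.+1)%N) (c (r i) - t) = \sum_i Num.max (c (r i) - t) 0.
    rewrite big_mkcond; apply: eq_bigr => i _; case: ifPn => ik.
      by rewrite max_l // subr_ge0 rP.
    rewrite -leqNgt in ik; rewrite max_r // subr_le0 rP //=; exact: ltnW.
  apply: le_trans (hinge t); rewrite big_mkcond; apply: ler_sum => i _.
  by case: ifP => _; rewrite le_max lexx ?orbT.
(* Adding the tangent inequalities at two distinct values of [m] shows that [g'] is monotone
   there. *)
- have := sP i j ij; rewrite le_eqVlt => /orP[/eqP->//|lt_m].
  have h1 := gP _ _ (Dm (s i)) (Dm (s j)); have h2 := gP _ _ (Dm (s j)) (Dm (s i)).
  have : 0 <= (g' (m (s i)) - g' (m (s j))) * (m (s i) - m (s j)) by lra.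
  by rewrite pmulr_lge0 ?subr_gt0 // subr_ge0.
Qed.

(** Lidskii's majorization as it is applied below: the hinge bounds and the equality of traces say
    that [c] majorizes the oppositely ordered sums [a i + b i]. The predicate [D] admits functions
    that are convex only on part of the line. *)
Lemma sum_convex_udiag (R : realType) n (D : pred R) (g g' : R -> R)
    (S T U : 'M[R[i]]_n) (a b c : 'I_n -> R) :
  {in D &, forall x y, g x + g' x * (y - x) <= g y} ->
  S \is unitarymx -> T \is unitarymx -> U \is unitarymx ->
  (forall i j : 'I_n, (i <= j)%N -> a j <= a i) ->
  (forall i j : 'I_n, (i <= j)%N -> b i <= b j) ->
  udiag S a + udiag T b = udiag U c ->
  (forall i, D (a i + b i)) -> (forall i, D (c i)) ->
  \sum_i g (a i + b i) <= \sum_i g (c i).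
Proof.
move=> gP uS uT uU a_dec b_inc abc Dab Dc.
apply: (hlp_hinge gP) => // [t|]; first exact: (sum_hinge_le t uS uT uU).
by rewrite -(rtr_udiag c uU) -abc rtrD !rtr_udiag // big_split.
Qed.

(** The case [g x = x ^+ 2] of the majorization: once the trace of the squared sum is expanded, the
    pure squares agree on both sides and only the cross terms remain. *)
Lemma von_neumann_trace (R : realType) n (S T : 'M[R[i]]_n) (a b : 'I_n -> R) :
  S \is unitarymx -> T \is unitarymx ->
  (forall i j : 'I_n, (i <= j)%N -> a j <= a i) ->
  (forall i j : 'I_n, (i <= j)%N -> b i <= b j) ->
  \sum_i a i * b i <= rtr (udiag S a *m udiag T b).
Proof.
move=> uS uT a_dec b_inc.
have [U [c [uU abc _]]] := herm_udiag_sorted (hermD (udiag_herm S a) (udiag_herm T b)).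
have gP : {in predT &, forall x y : R, x ^+ 2 + 2 * x * (y - x) <= y ^+ 2}.
  by move=> x y _ _; have := sqr_ge0 (y - x); lra.
have := sum_convex_udiag gP uS uT uU a_dec b_inc abc (fun=> isT) (fun=> isT).
have -> : \sum_i c i ^+ 2 = rtr ((udiag S a + udiag T b) *m (udiag S a + udiag T b)).
  by rewrite abc udiagM // rtr_udiag //.
rewrite mulmxDl !mulmxDr !rtrD [rtr (udiag T b *m udiag S a)]rtrC !udiagM //.
rewrite [rtr (udiag S _)]rtr_udiag // [rtr (udiag T _)]rtr_udiag //.
have -> : \sum_i (a i + b i) ^+ 2 =
    \sum_i a i * a i + \sum_i b i * b i + 2 * \sum_i a i * b i.
  by rewrite mulr_sumr -!big_split; apply: eq_bigr => i _ /=; ring.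
by lra.
Qed.

(** * Positivity read off the spectrum *)

Lemma udiag_form_gt0 (R : realType) n (T : 'M[R[i]]_n) (a : 'I_n -> R) (v : 'cV_n) :
  T \is unitarymx -> (forall i, 0 < a i) -> v != 0 ->
  0 < (v ^t* *m udiag T a *m v) 0 0.
Proof.
move=> uT a0 v0; rewrite lt_neqAle udiag_form_ge0 ?andbT => [|i]; last exact: ltW.
have t0 i : 0 <= (a i)%:C * `|(T *m v) i 0| ^+ 2.
  by rewrite mulr_ge0 ?exprn_ge0 // ler0c ltW.
apply: contra_neq v0 => /esym/eqP; rewrite udiag_form psumr_eq0 // => /allP z.
suff Tv0 : T *m v = 0 by rewrite -[v]mul1mx -(unitarymxVl uT) -mulmxA Tv0 mulmx0.
apply/colP => i; have := z i; rewrite mem_index_enum => /(_ isT) /=.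
rewrite mulf_eq0 expf_eq0 /= normr_eq0 [X in _ -> _ = X]mxE.
by case/orP => /eqP // /complexI ai0; have := a0 i; rewrite ai0 ltxx.
Qed.

Lemma udiag_form_eigen (R : realType) n (T : 'M[R[i]]_n) (a : 'I_n -> R) i :
  T \is unitarymx -> exists2 v : 'cV_n, v != 0 &
  (v ^t* *m udiag T a *m v) 0 0 = (a i)%:C.
Proof.
move=> uT; exists (T ^t* *m delta_mx i 0).
  apply/eqP => /(congr1 (mulmx T)); rewrite mulmxA (unitarymxP uT) mul1mx mulmx0.
  by move=> /matrixP /(_ i 0); rewrite !mxE !eqxx => /eqP; rewrite oner_eq0.
rewrite udiag_form mulmxA (unitarymxP uT) mul1mx (bigD1 i) //= big1 => [|j ji].
  by rewrite mxE !eqxx normr1 expr1n mulr1 addr0.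
by rewrite mxE (negPf ji) normr0 expr0n mulr0.
Qed.

Lemma psd_udiag (R : realType) n (T : 'M[R[i]]_n) (a : 'I_n -> R) :
  T \is unitarymx -> psd (udiag T a) <-> forall i, 0 <= a i.
Proof.
move=> uT; split=> [[_ form0] i|a0]; last first.
  by split=> [|v]; [exact: udiag_herm|exact: udiag_form_ge0].
have [v _ vE] := udiag_form_eigen a i uT.
by have := form0 v; rewrite vE ler0c.
Qed.

Lemma posdef_udiag (R : realType) n (T : 'M[R[i]]_n) (a : 'I_n -> R) :
  T \is unitarymx -> posdef (udiag T a) <-> forall i, 0 < a i.
Proof.
move=> uT; split=> [[_ form0] i|a0]; last first.
  by split=> [|v]; [exact: udiag_herm|exact: udiag_form_gt0].
have [v v0 vE] := udiag_form_eigen a i uT.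
by have := form0 v v0; rewrite vE ltcR.
Qed.

Lemma posdef_unit (R : realType) n (A : 'M[R[i]]_n) : posdef A -> A \in unitmx.
Proof.
move=> [hA A0]; rewrite (herm_udiag hA) in A0 *.
have uT := spectral_unitarymx A.
apply: (proj1 (udiagV uT _)) => i; rewrite gt_eqF //.
by move: i; apply/(posdef_udiag _ uT); split; first exact: udiag_herm.
Qed.

(** The majorization for [x^-1], convex on the positive reals; the spectrum of the sum lies there
    because both summands are positive definite. *)
Lemma rtr_inv_add_ge (R : realType) n (S T : 'M[R[i]]_n) (a b : 'I_n -> R) :
  S \is unitarymx -> T \is unitarymx ->
  (forall i j : 'I_n, (i <= j)%N -> a j <= a i) ->
  (forall i j : 'I_n, (i <= j)%N -> b i <= b j) ->
  (forall i, 0 < a i) -> (forall i, 0 < b i) ->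
  \sum_i (a i + b i)^-1 <= rtr (invmx (udiag S a + udiag T b)).
Proof.
move=> uS uT a_dec b_inc a0 b0.
have hC := hermD (udiag_herm S a) (udiag_herm T b).
have [U [c [uU abc _]]] := herm_udiag_sorted hC.
have c0 : forall i, 0 < c i.
  apply/(posdef_udiag _ uU); rewrite -abc; split=> // v v0.
  by rewrite formD addr_gt0 // udiag_form_gt0.
have gP : {in [pred x : R | 0 < x] &,
    forall x y : R, x^-1 + - x ^- 2 * (y - x) <= y^-1}.
  move=> x y; rewrite !inE => x0 y0; rewrite -subr_ge0.
  have -> : y^-1 - (x^-1 + - x ^- 2 * (y - x)) = (x - y) ^+ 2 / (x ^+ 2 * y).
    by field; rewrite !gt_eqF.
  by rewrite divr_ge0 ?sqr_ge0 // mulr_ge0 ?sqr_ge0 // ltW.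
have ab0 i : 0 < a i + b i by rewrite addr_gt0.
have := sum_convex_udiag gP uS uT uU a_dec b_inc abc ab0 c0.
rewrite abc; have [_ ->] := udiagV uU (fun i => lt0r_neq0 (c0 i)).
by rewrite rtr_udiag.
Qed.

(** * Quotients of matrix pencils *)

(** Every factor [M] cancels [invmx M], so the inverse survives only in the term quadratic in [B].
    The other two traces do not see the relative position of the eigenbases. *)
Lemma rtr_conj_expand (R : realType) n (M B : 'M[R[i]]_n) (k : R) :
  M \in unitmx ->
  rtr ((M - k%:C *: B) *m invmx M *m (M - k%:C *: B))
    = rtr M - 2 * k * rtr B + k ^+ 2 * rtr (B *m invmx M *m B).
Proof.
move=> uM.
rewrite mulmxBl mulmxV // mulmxBr !mulmxBl !mul1mx -!scalemxAl mulmxKV //.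
rewrite -!scalemxAr !rtrB !rtrZ.
by ring.
Qed.

Lemma invmxM (R : realType) n (A B : 'M[R[i]]_n) :
  A \in unitmx -> B \in unitmx -> invmx (A *m B) = invmx B *m invmx A.
Proof.
move=> uA uB; have uAB : A *m B \in unitmx by rewrite unitmx_mul uA.
apply: (can_inj (mulKmx uAB)).
by rewrite mulmxV // mulmxA -(mulmxA A) mulmxV // mulmx1 mulmxV.
Qed.

(** The inverses sum to [invmx P *m (P + Q) *m invmx Q], so their parallel sum is
    [Q *m invmx (P + Q) *m P]; added to the left-hand side it gives [Q]. *)
Lemma parallel_sumE (R : realType) n (P Q : 'M[R[i]]_n) :
  P \in unitmx -> Q \in unitmx -> P + Q \in unitmx ->
  Q *m invmx (P + Q) *m Q = Q - invmx (invmx P + invmx Q).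
Proof.
move=> uP uQ uM.
have -> : invmx P + invmx Q = invmx P *m (P + Q) *m invmx Q.
  by rewrite mulmxDr mulVmx // mulmxDl mul1mx mulmxK // addrC.
rewrite !invmxM ?unitmx_mul ?unitmx_inv ?uP // !invmxK mulmxA.
by apply/esym/eqP; rewrite subr_eq -mulmxDr [Q + P]addrC mulmxKV.
Qed.

Lemma posdefD (R : realType) n (A B : 'M[R[i]]_n) :
  posdef A -> psd B -> posdef (A + B).
Proof.
move=> [hA A0] [hB B0]; split=> [|v v0]; first exact: hermD.
by rewrite formD ltr_wpDr // A0.
Qed.

Lemma psdD (R : realType) n (A B : 'M[R[i]]_n) : psd A -> psd B -> psd (A + B).
Proof.
move=> [hA A0] [hB B0]; split=> [|v]; first exact: hermD.
by rewrite formD addr_ge0.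
Qed.

Lemma hermB (R : realType) n (A B : 'M[R[i]]_n) :
  A \is hermsymmx -> B \is hermsymmx -> A - B \is hermsymmx.
Proof.
move=> hA hB; apply: (hermD hA).
by rewrite (herm_udiag hB) udiagN; exact: udiag_herm.
Qed.

Lemma psdZ (R : realType) n (A : 'M[R[i]]_n) (k : R) :
  0 <= k -> psd A -> psd (k%:C *: A).
Proof.
move=> k0 [hA A0]; split=> [|v].
  rewrite (herm_udiag hA) udiagZ; exact: udiag_herm.
by rewrite -scalemxAr -scalemxAl mxE mulr_ge0 // ler0c.
Qed.

Lemma posdef_psd (R : realType) n (A : 'M[R[i]]_n) : posdef A -> psd A.
Proof.
move=> [hA A0]; split=> // v; have [->|v0] := eqVneq v 0; last exact/ltW/A0.
by rewrite mulmx0 mxE.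
Qed.

(** For positive definite arguments this is Tr S h(X) with X = S^(-1/2) P S^(-1/2) and h(x) = (x -
    1)^2 / (x + s), the integrand in the representation of f, written without square roots. *)
Definition pencil_div (R : realType) n (P S : 'M[R[i]]_n) (s : R) : R :=
  rtr ((P - S) *m invmx (P + s%:C *: S) *m (P - S)).

(** A quantum chi-squared divergence: the same trace for h(x) = (x - 1)^2, the term with coefficient
    c. *)
Definition chi2_div (R : realType) n (P S : 'M[R[i]]_n) : R :=
  rtr ((P - S) *m invmx S *m (P - S)).

(** Von Neumann's inequality bounds oppositely ordered products from below. The factors here are
    ordered alike, so negating one of them turns it into an upper bound. *)
Lemma rtr_mul_inv_mul_le (R : realType) n (V Y : 'M[R[i]]_n) (r d : 'I_n -> R) :
  V \is unitarymx -> Y \is unitarymx ->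
  (forall i j : 'I_n, (i <= j)%N -> r j <= r i) ->
  (forall i j : 'I_n, (i <= j)%N -> d i <= d j) ->
  (forall i, 0 < r i) -> (forall i, 0 < d i) ->
  rtr (udiag Y d *m invmx (udiag V r) *m udiag Y d) <= \sum_i d i ^+ 2 / r i /\
  rtr (udiag V r *m invmx (udiag Y d) *m udiag V r) <= \sum_i r i ^+ 2 / d i.
Proof.
move=> uV uY r_dec d_inc r0 d0.
have [_ ->] := udiagV uV (fun i => lt0r_neq0 (r0 i)).
have [_ ->] := udiagV uY (fun i => lt0r_neq0 (d0 i)).
split; rewrite rtrC mulmxA udiagM //.
- have := @von_neumann_trace _ _ Y V (fun i => - (d i * d i)) (fun i => (r i)^-1) uY uV.
  rewrite -udiagN mulNmx rtrN => H.
  rewrite -lerN2; apply: le_trans (H _ _).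
  + by rewrite -sumrN; apply: ler_sum => i _; rewrite expr2 mulNr.
  + by move=> i j ij; rewrite lerN2; apply: ler_pM; rewrite ?d_inc ?ltW.
  + by move=> i j ij; rewrite lef_pV2 ?posrE ?r_dec.
- have := @von_neumann_trace _ _ V Y (fun i => r i * r i) (fun i => - (d i)^-1) uV uY.
  rewrite -udiagN mulmxN rtrN => H.
  rewrite -lerN2; apply: le_trans (H _ _).
  + by rewrite -sumrN; apply: ler_sum => i _; rewrite expr2 mulrN.
  + by move=> i j ij; apply: ler_pM; rewrite ?r_dec ?ltW.
  + by move=> i j ij; rewrite lerN2 lef_pV2 ?posrE ?d_inc.
Qed.

Lemma chi2_div_le (R : realType) n (V Y : 'M[R[i]]_n) (r d : 'I_n -> R) :
  V \is unitarymx -> Y \is unitarymx ->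
  (forall i j : 'I_n, (i <= j)%N -> r j <= r i) ->
  (forall i j : 'I_n, (i <= j)%N -> d i <= d j) ->
  (forall i, 0 < r i) -> (forall i, 0 < d i) ->
  chi2_div (udiag V r) (udiag Y d) <= \sum_i (r i - d i) ^+ 2 / d i.
Proof.
move=> uV uY r_dec d_inc r0 d0.
have [_ Hle] := rtr_mul_inv_mul_le uV uY r_dec d_inc r0 d0.
have [uS _] := udiagV uY (fun i => lt0r_neq0 (d0 i)).
(* The sign of the difference is flipped on both sides so that the expansion applies with [M] the
   second matrix, the one that is inverted, and [k = 1]. *)
rewrite /chi2_div -(opprB (udiag Y d)) mulNmx mulmxN mulNmx opprK.
have := rtr_conj_expand (udiag V r) 1 uS; rewrite rmorph1 scale1r => ->.
apply: le_trans (_ : _ <= \sum_i d i - 2 * \sum_i r i + \sum_i r i ^+ 2 / d i) _.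
  by rewrite !rtr_udiag // mulr1 expr1n mul1r lerD2l.
rewrite mulr_sumr -sumrB -big_split /= ler_sum // => i _.
by rewrite le_eqVlt; apply/orP; left; apply/eqP; field; rewrite gt_eqF.
Qed.

(** With M = P + s S one has P - S = M - (1 + s) S. After expansion only Tr (S M^-1 S) depends on
    the eigenbases, and [key] bounds it. *)
Lemma pencil_div_le (R : realType) n (V Y : 'M[R[i]]_n) (r d : 'I_n -> R) (s : R) :
  V \is unitarymx -> Y \is unitarymx ->
  (forall i j : 'I_n, (i <= j)%N -> r j <= r i) ->
  (forall i j : 'I_n, (i <= j)%N -> d i <= d j) ->
  (forall i, 0 < r i) -> (forall i, 0 < d i) -> 0 <= s ->
  pencil_div (udiag V r) (udiag Y d) s <= \sum_i (r i - d i) ^+ 2 / (r i + s * d i).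
Proof.
move=> uV uY r_dec d_inc r0 d0 s0.
have pP : posdef (udiag V r) by apply/posdef_udiag.
have pS : posdef (udiag Y d) by apply/posdef_udiag.
have uM := posdef_unit (posdefD pP (psdZ s0 (posdef_psd pS))).
have den0 i : 0 < r i + s * d i by rewrite ltr_wpDr // mulr_ge0 // ltW.
have key : rtr (udiag Y d *m invmx (udiag V r + s%:C *: udiag Y d) *m udiag Y d)
    <= \sum_i d i ^+ 2 / (r i + s * d i).
  have [->|sn0] := eqVneq s 0.
    rewrite rmorph0 scale0r addr0.
    have [+ _] := rtr_mul_inv_mul_le uV uY r_dec d_inc r0 d0.
    by under [in X in _ -> X]eq_bigr do rewrite mul0r addr0.
  have sp : 0 < s by rewrite lt_neqAle eq_sym sn0.
  have sd0 i : 0 < s * d i by rewrite mulr_gt0.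
  set Q := s%:C *: udiag Y d in uM *.
  have QE : Q = udiag Y (fun i => s * d i) by rewrite /Q udiagZ.
  have [uQ QV] : Q \in unitmx /\ invmx Q = udiag Y (fun i => (s * d i)^-1).
    by rewrite QE; apply: udiagV => // i; rewrite lt0r_neq0.
  have [uP PV] := udiagV uV (fun i => lt0r_neq0 (r0 i)).
  have -> : udiag Y d = (s^-1)%:C *: Q.
    by rewrite QE udiagZ; apply: eq_udiag => i; rewrite mulKf.
  rewrite -scalemxAl -scalemxAr -scalemxAl !rtrZ parallel_sumE // rtrB.
  rewrite PV QV [udiag V _ + _]addrC QE rtr_udiag //.
  (* Inversion reverses both orders, so the two spectra remain oppositely ordered, with their roles
     exchanged. *)
  have Hinv : \sum_i ((s * d i)^-1 + (r i)^-1)^-1 <=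
      rtr (invmx (udiag Y (fun i => (s * d i)^-1) + udiag V (fun i => (r i)^-1))).
    apply: rtr_inv_add_ge => // [i j ij|i j ij|i|i]; rewrite ?invr_gt0 //.
      by rewrite lef_pV2 ?posrE // ler_pM2l // d_inc.
    by rewrite lef_pV2 ?posrE ?r_dec.
  apply: le_trans (_ : _ <= s^-1 * (s^-1 * (\sum_i s * d i
     - \sum_i ((s * d i)^-1 + (r i)^-1)^-1))) _.
    by rewrite !ler_pM2l ?invr_gt0 // lerD2l lerN2.
  rewrite -sumrB !mulr_sumr ler_sum // => i _.
  rewrite le_eqVlt; apply/orP; left; apply/eqP; field.
  have := r0 i; have := d0 i; have := den0 i => h1 h2 h3.
  by rewrite sn0 !gt_eqF //= addrC.
have ME : udiag V r - udiag Y d =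
    udiag V r + s%:C *: udiag Y d - (1 + s)%:C *: udiag Y d.
  by rewrite rmorphD scalerDl rmorph1 scale1r opprD [- _ - _]addrC addrA addrK.
rewrite /pencil_div ME rtr_conj_expand //.
rewrite rtrD rtrZ !rtr_udiag //.
have s10 : 0 <= (1 + s) ^+ 2 by exact: sqr_ge0.
apply: le_trans (lerD (lexx _) (ler_wpM2l s10 key)) _.
rewrite !mulr_sumr -big_split -sumrB -big_split /= ler_sum // => i _.
by rewrite le_eqVlt; apply/orP; left; apply/eqP; field; rewrite gt_eqF.
Qed.

Lemma psd_diag_ge0 (R : realType) n (A T : 'M[R[i]]_n) i :
  psd A -> 0 <= complex.Re ((T *m A *m T ^t*) i i).
Proof.
move=> [_ A0]; pose v : 'cV_n := T ^t* *m delta_mx i 0.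
have -> : (T *m A *m T ^t*) i i = (v ^t* *m A *m v) 0 0.
  rewrite /v trmxC_mul trmxCK.
  have -> : (delta_mx i 0) ^t* = delta_mx 0 i :> 'rV[R[i]]_n.
    by rewrite trmx_delta; apply/matrixP => j k; rewrite !mxE; exact: conjc_nat.
  by rewrite !mulmxA -colE [RHS]mxE -!mulmxA -rowE [RHS]mxE.
by have := A0 v; rewrite lecE => /andP[].
Qed.

Lemma psd_sqr (R : realType) n (A : 'M[R[i]]_n) : A \is hermsymmx -> psd (A *m A).
Proof.
have uT := spectral_unitarymx A.
move=> hA; rewrite (herm_udiag hA) (udiagM _ _ uT).
by apply/(psd_udiag _ uT) => i; rewrite -expr2 sqr_ge0.
Qed.

(** In the eigenbasis of [K] the trace is a combination of the numbers [(k i + t)^-1], whose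
    coefficients are the diagonal entries of the positive semidefinite [X *m X]. *)
Lemma rtr_resolvent_antitone (R : realType) n (K X : 'M[R[i]]_n) (t u : R) :
  psd K -> X \is hermsymmx -> 0 < t -> t <= u ->
  rtr (X *m invmx (addeps K u) *m X) <= rtr (X *m invmx (addeps K t) *m X).
Proof.
move=> pK hX t0 tu; have [hK _] := pK.
have [T [k [uT KE _]]] := herm_udiag_sorted hK; subst K.
have k0 : forall i, 0 <= k i by apply/(psd_udiag _ uT).
have kt0 v : 0 < v -> forall i, 0 < k i + v.
  by move=> v0 i; rewrite ltr_wpDl.
have E v : 0 < v -> invmx (addeps (udiag T k) v) = udiag T (fun i => (k i + v)^-1).
  move=> v0; rewrite /addeps -(udiag_scalar v uT) udiagD.
  by have [] := udiagV uT (fun i => lt0r_neq0 (kt0 v v0 i)).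
have u0 := lt_le_trans t0 tu.
have EX v : 0 < v -> rtr (X *m invmx (addeps (udiag T k) v) *m X) =
    \sum_i complex.Re ((T *m (X *m X) *m T ^t*) i i) * (k i + v)^-1.
  by move=> v0; rewrite (E _ v0) rtrC mulmxA rtr_mul_udiag.
rewrite (EX _ u0) (EX _ t0); apply: ler_sum => i _.
rewrite ler_wpM2l //; first exact/psd_diag_ge0/psd_sqr.
by rewrite lef_pV2 ?posrE ?kt0 // lerD2l.
Qed.

(** * The maximal divergence of a positive definite pair *)

Lemma mxfun_udiag (R : realType) n (f : R -> R) (A : 'M[R[i]]_n) :
  mxfun f A = udiag (spectralmx A) (fun i => f (complex.Re (spectral_diag A 0 i))).
Proof.
rewrite /mxfun (invmx_unitary (spectral_unitarymx A)).
have -> // : map_mx (fun z => (f (complex.Re z))%:C) (spectral_diag A) =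
  \row_i (f (complex.Re (spectral_diag A 0 i)))%:C.
by apply/rowP => i; rewrite !mxE.
Qed.

Lemma posdef_conj (R : realType) n (A B : 'M[R[i]]_n) :
  posdef A -> B \is hermsymmx -> B \in unitmx -> posdef (B *m A *m B).
Proof.
move=> [hA A0] hB uB; have hB' := hermsymmxP hB; split=> [|v v0].
  by rewrite hermsymmxE !trmxC_mul hB' (hermsymmxP hA) mulmxA.
have -> : v ^t* *m (B *m A *m B) *m v = (B *m v) ^t* *m A *m (B *m v).
  by rewrite trmxC_mul hB' !mulmxA.
by apply: A0; apply: contra_neq v0 => Bv; rewrite -[v](mulKmx uB) Bv mulmx0.
Qed.

(** Here [q] is an inverse square root of [S]. Cyclicity of the trace brings [q *m S *m q] together,
    which turns spectral expressions in [q *m X *m q] into quotients free of square roots. *)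
Lemma rtr_congr_quotient (R : realType) n (q S X M : 'M[R[i]]_n) :
  q *m S *m q = 1%:M -> M \in unitmx ->
  [/\ forall A, rtr (S *m (q *m A *m q)) = rtr A,
      rtr (S *m ((q *m X *m q) *m (q *m X *m q))) = rtr (X *m (q *m q) *m X)
    & rtr (S *m (q *m X *m q *m invmx (q *m M *m q) *m (q *m X *m q)))
        = rtr (X *m invmx M *m X)].
Proof.
move=> qSq uM.
have uq : q \in unitmx by rewrite -mulmxA in qSq; have [] := mulmx1_unit qSq.
have tr A : rtr (S *m (q *m A *m q)) = rtr A.
  by rewrite rtrC -(mulmxA (q *m A)) rtrC mulmxA qSq mul1mx.
have uqM : q *m M \in unitmx by rewrite unitmx_mul uq.
split; first exact: tr.
  by rewrite -[RHS]tr !mulmxA.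
rewrite -[RHS]tr (invmxM uqM uq) (invmxM uq uM) !mulmxA.
by rewrite (mulmxK uq) (mulmxKV uq).
Qed.

(* [w i] is the weight of [sigma] on the [i]-th eigenvector of
   [sigma^{-1/2} rho sigma^{-1/2}], whose eigenvalue is [x i]. *)
Lemma maxdiv_pd_spectral (R : realType) n (P S : 'M[R[i]]_n) :
  posdef P -> posdef S ->
  exists w x : 'I_n -> R,
  [/\ (forall i, 0 <= w i), (forall i, 0 < x i),
      (forall f, maxdiv_pd f P S = \sum_i w i * f (x i)),
      \sum_i w i = rtr S /\ \sum_i w i * (x i - 1) = rtr P - rtr S
    & \sum_i w i * (x i - 1) ^+ 2 = chi2_div P S /\
      forall s, 0 <= s ->
        \sum_i w i * ((x i - 1) ^+ 2 / (x i + s)) = pencil_div P S s].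
Proof.
move=> pP pS; have [hS _] := pS.
pose Y := spectralmx S; pose d i := complex.Re (spectral_diag S 0 i).
have uY : Y \is unitarymx by exact: spectral_unitarymx.
have SE : S = udiag Y d by exact: herm_udiag.
have d0 : forall i, 0 < d i by apply/(posdef_udiag _ uY); rewrite -SE.
pose q := udiag Y (fun i => (Num.sqrt (d i))^-1).
have qE : mxfun (fun x => (Num.sqrt x)^-1) S = q by exact: mxfun_udiag.
clearbody d Y.
have sq0 i : 0 < Num.sqrt (d i) by rewrite sqrtr_gt0.
have hq : q \is hermsymmx by exact: udiag_herm.
have uq : q \in unitmx.
  by have [] := udiagV uY (fun i => lt0r_neq0 (etrans (invr_gt0 _) (sq0 i))).
have qSq : q *m S *m q = 1%:M.
  rewrite SE /q !(udiagM _ _ uY) -(udiag_scalar 1 uY); apply: eq_udiag => i.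
  rewrite -{2}(sqr_sqrtr (ltW (d0 i))); field; exact: lt0r_neq0.
have uS := posdef_unit pS.
have qq : q *m q = invmx S.
  have [_] := udiagV uY (fun i => lt0r_neq0 (d0 i)); rewrite -SE => ->.
  rewrite /q (udiagM _ _ uY); apply: eq_udiag => i.
  by rewrite -invfM -expr2 sqr_sqrtr // ltW.
clearbody q; pose X := q *m P *m q.
have pX : posdef X by exact: posdef_conj.
pose T := spectralmx X; pose x i := complex.Re (spectral_diag X 0 i).
have uT : T \is unitarymx by exact: spectral_unitarymx.
have XE : X = udiag T x by apply: herm_udiag; case: pX.
have x0 : forall i, 0 < x i by apply/(posdef_udiag _ uT); rewrite -XE.
pose w i := complex.Re ((T *m S *m T ^t*) i i).
have wE h : \sum_i w i * h i = rtr (S *m udiag T h) by rewrite rtr_mul_udiag.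
have maxE f : maxdiv_pd f P S = \sum_i w i * f (x i).
  by rewrite wE /maxdiv_pd qE; congr (rtr (_ *m _)); exact: mxfun_udiag.
have w0 i : 0 <= w i by apply/psd_diag_ge0/posdef_psd.
clearbody w x T; rewrite /X in XE; clear X pX.
(* Since [q *m S *m q] is the identity, shifting the spectrum of [q *m P *m q] by a scalar amounts
   to adding that multiple of [S] to [P]. *)
have X1 : udiag T (fun i => x i - 1) = q *m (P - S) *m q.
  by rewrite mulmxBr mulmxBl qSq XE -(udiag_scalar 1 uT) udiagN udiagD.
have Xs s : udiag T (fun i => x i + s) = q *m (P + s%:C *: S) *m q.
  rewrite mulmxDr mulmxDl -scalemxAr -scalemxAl qSq XE scalemx1.
  by rewrite -(udiag_scalar s uT) udiagD.
have [tr_q tr_sq _] := rtr_congr_quotient (P - S) qSq uS.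
exists w, x; split; [exact: w0|exact: x0|exact: maxE| |].
- split; last by rewrite wE X1 tr_q rtrB.
  rewrite -[S in RHS]mulmx1 -(udiag_scalar 1 uT) -wE.
  by apply: eq_bigr => i _; rewrite mulr1.
split=> [|s s0].
  by rewrite wE -(udiagM (fun i => x i - 1) _ uT) X1 tr_sq qq.
have uM := posdef_unit (posdefD pP (psdZ s0 (posdef_psd pS))).
have [_ _ tr_quot] := rtr_congr_quotient (P - S) qSq uM.
have xs0 i : x i + s != 0 by rewrite gt_eqF // ltr_pwDl.
rewrite /pencil_div -tr_quot -Xs -X1; have [_ ->] := udiagV uT xs0.
rewrite !(udiagM _ _ uT) -wE.
by apply: eq_bigr => i _; rewrite expr2 mulrAC.
Qed.

(** * The integral form of the divergence *)

Lemma measurable_div_affine (R : realType) (k a b : R) : 0 <= k -> 0 < a -> 0 <= b ->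
  measurable_fun (`[0, +oo[ : set (measurableTypeR R)) (fun s => (k / (a + s * b))%:E).
Proof.
move=> k0 a0 b0; apply/measurable_EFinP.
have den u : 0 < a + Num.max u 0 * b.
  by rewrite ltr_pwDl // mulr_ge0 // le_max lexx orbT.
(* Replacing [s] by [Num.max s 0] keeps the denominator positive on the whole line, where the
   function is then nonincreasing and hence measurable. *)
have mf : measurable_fun (`[0, +oo[ : set (measurableTypeR R))
    (fun s : R => k / (a + Num.max s 0 * b)).
  apply: nonincreasing_measurable => // s t st; rewrite ler_wpM2l //.
  rewrite lef_pV2 ?posrE ?den // lerD2l ler_wpM2r //.
  by rewrite ge_max !le_max st lexx orbT.
apply: eq_measurable_fun mf => s; rewrite inE /= in_itv /= andbT => s0.
by rewrite max_l.
Qed.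

Lemma mem_itv0y (R : realType) (s : R) : (`[0%R, +oo[%classic : set R) s -> 0 <= s.
Proof. by rewrite /= in_itv /= andbT. Qed.

(** The representation of [f] is summed over the eigenvalues [x i] with weights [w i]. Equality of
    the traces kills the term in the derivative of [f]. *)
Lemma maxdiv_pd_integral (R : realType) n (f : R -> R) (c : R)
    (lam : {measure set (measurableTypeR R) -> \bar R}) (P S : 'M[R[i]]_n) :
  opconv_repr f c lam -> posdef P -> posdef S -> rtr P = rtr S ->
  [/\ 0 <= chi2_div P S, (forall s, 0 <= s -> 0 <= pencil_div P S s),
      measurable_fun (`[0, +oo[ : set (measurableTypeR R))
        (fun s => (pencil_div P S s)%:E)
    & ((maxdiv_pd f P S)%:E = (f 1 * rtr S)%:E + ((c * chi2_div P S)%:E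
       + \int[lam]_(s in `[0%R, +oo[) (pencil_div P S s)%:E))%E].
Proof.
move=> [c0 _ fE] pP pS trPS.
have [w [x [w0 x0 divE [w_sum w_sum1] [<- pencilE]]]] := maxdiv_pd_spectral pP pS.
have {}pencilE s : 0 <= s -> pencil_div P S s =
    \sum_i w i * (x i - 1) ^+ 2 / (x i + s * 1).
  move=> s0; rewrite -pencilE //; apply: eq_bigr => i _.
  by rewrite mulr1 mulrA.
have mt i : measurable_fun (`[0, +oo[ : set (measurableTypeR R))
    (fun s => (w i * (x i - 1) ^+ 2 / (x i + s * 1))%:E).
  by apply: measurable_div_affine => //; rewrite mulr_ge0 ?sqr_ge0.
have t0 i (s : R) : 0 <= s -> 0 <= w i * (x i - 1) ^+ 2 / (x i + s * 1).
  move=> s0; apply: divr_ge0; first by rewrite mulr_ge0 ?sqr_ge0.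
  by rewrite mulr1 addr_ge0 // ltW.
have pE s : (`[0%R, +oo[%classic : set R) s -> (pencil_div P S s)%:E =
    (\sum_i (w i * (x i - 1) ^+ 2 / (x i + s * 1))%:E)%E.
  by move=> /mem_itv0y s0; rewrite pencilE // sumEFin.
split.
- by apply: sumr_ge0 => i _; rewrite mulr_ge0 ?sqr_ge0.
- by move=> s s0; rewrite pencilE // sumr_ge0 // => i _; exact: t0.
- have mS := emeasurable_sum (index_enum 'I_n) mt.
  by apply: eq_measurable_fun mS => s /set_mem /pE ->.
rewrite (eq_integral (fun s : measurableTypeR R =>
    (\sum_i (w i * (x i - 1) ^+ 2 / (x i + (s : R) * 1))%:E)%E)); last first.
  by move=> s /set_mem /pE ->.
rewrite ge0_integral_sum //; last by move=> i s /mem_itv0y s0; rewrite lee_fin t0.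
(* Each integral is finite because [f (x i)] is a real number, so the weighted sum can be computed
   in the reals. *)
have intE i : exists2 J : R, (\int[lam]_(s in `[0%R, +oo[)
     ((x i - 1) ^+ 2 / (x i + s))%:E = J%:E)%E &
     f (x i) = f 1 + derive1 f 1 * (x i - 1) + c * (x i - 1) ^+ 2 + J.
  have := fE (x i) (x0 i); case: integral => [J| |] //= [->].
  by exists J.
have wintE i : (\int[lam]_(s in `[0%R, +oo[)
     (w i * (x i - 1) ^+ 2 / (x i + s * 1))%:E = (w i * (f (x i) -
       (f 1 + derive1 f 1 * (x i - 1) + c * (x i - 1) ^+ 2)))%:E)%E.
  have [J JE ->] := intE i.
  rewrite [X in (w i * X)%:E](_ : _ = J); last by ring.
  rewrite EFinM -JE -ge0_integralZl_EFin //.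
  - by apply: eq_integral => s _; rewrite -EFinM mulr1 -mulrA.
  - move=> s /mem_itv0y s0; rewrite lee_fin divr_ge0 ?sqr_ge0 //.
    by rewrite addr_ge0 // ltW.
  - have := measurable_div_affine (sqr_ge0 (x i - 1)) (x0 i) ler01.
    by apply: eq_measurable_fun => s _; rewrite mulr1.
rewrite (eq_bigr _ (fun i _ => wintE i)) sumEFin -!EFinD; congr EFin.
have Z : derive1 f 1 * (\sum_i w i * (x i - 1)) = 0.
  by rewrite w_sum1 trPS subrr mulr0.
rewrite divE -w_sum -[RHS]addr0 -[X in _ = _ + X]Z !mulr_sumr -!big_split.
by apply: eq_bigr => i _ /=; ring.
Qed.

(** * The regularization limit *)

(* Quotient of nonnegative reals with [0 / 0 = 0] and [x / 0 = +oo]. *)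
Definition equot (R : realType) (x y : R) : \bar R :=
  if x == 0 then 0%E else if y == 0 then +oo%E else (x / y)%:E.

Lemma equot_ge0 (R : realType) (x y : R) : 0 <= x -> 0 <= y -> (0 <= equot x y)%E.
Proof.
move=> x0 y0; rewrite /equot; case: ifP => // _; case: ifP => // _.
by rewrite lee_fin divr_ge0.
Qed.

Lemma cvg_at_right0_id (R : realType) : (fun e : R => e) @ 0^'+ --> (0 : R).
Proof. exact: cvg_at_right_filter. Qed.

(** For 0 / 0 the limit is 0 because the numerator is assumed identically zero in that case. If only
    the denominator tends to 0, the numerator eventually exceeds [x0 / 2] and the quotient passes
    every bound [A]. *)
Lemma cvg_equot (R : realType) (x y : R -> R) (x0 y0 : R) :
  x @ 0^'+ --> x0 -> y @ 0^'+ --> y0 -> (forall e, 0 < e -> 0 < y e) ->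
  0 <= x0 -> (x0 = 0 -> y0 = 0 -> forall e, x e = 0) ->
  (x e / y e)%:E @[e --> 0^'+] --> equot x0 y0.
Proof.
move=> cx cy ypos x0ge0 xy00; rewrite /equot.
have [y00|yn0] := eqVneq y0 0; last first.
  rewrite (_ : (if _ then _ else _) = (x0 / y0)%:E); last first.
    by case: eqP => [->|//]; rewrite mul0r.
  by apply: cvg_EFin; [exact: nearW|exact: cvgM cx (cvgV yn0 cy)].
have [x00|xn0] := eqVneq x0 0.
  rewrite (_ : (fun e => _) = fun=> 0%E); first exact: cvg_cst.
  by apply/funext => e; rewrite xy00 // mul0r.
have xpos : 0 < x0 by rewrite lt_neqAle eq_sym xn0.
rewrite y00 in cy.
apply/cvgeyPge => A.
have [A0|A0] := leP A 0.
  near=> e; rewrite lee_fin (le_trans A0) // divr_ge0 //.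
    near: e; apply: (cvgr_ge x0) => //.
  by rewrite ltW // ypos.
have h : 0 < x0 / 2 by rewrite divr_gt0.
near=> e; rewrite lee_fin ler_pdivlMr; last by apply: ypos.
apply: (@le_trans _ _ (x0 / 2)); last first.
  by near: e; apply: (cvgr_ge x0) => //; rewrite gtr_pMr // invf_lt1 // ltr1n.
rewrite mulrC -ler_pdivlMr //.
by near: e; apply: (cvgr_le 0) => //; rewrite divr_gt0.
Unshelve. all: by end_near. Qed.

(** Lets a limit in the regularization parameter be computed along a sequence of positive numbers,
    as monotone convergence requires. *)
Lemma harmonic_at_right (R : realType) : @harmonic R @ \oo --> (0 : R)^'+.
Proof.
move=> A; rewrite /at_right /within /= => A0.
have H : \forall n \near \oo, 0 < @harmonic R n -> A (harmonic n).
  exact: (@cvg_harmonic R _ A0).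
change (\forall n \near \oo, A (@harmonic R n)).
by apply: filterS H => n; apply; exact: harmonic_gt0.
Qed.

Lemma cvg_harmonic_comp (R : realType) (F : R -> \bar R) (l : \bar R) :
  F e @[e --> 0^'+] --> l -> F (harmonic n) @[n --> \oo] --> l.
Proof. by move=> Fl; apply: (cvg_comp (@harmonic R) F); [exact: harmonic_at_right|]. Qed.

Lemma pencil_shift_gt0 (R : realType) (r d s e : R) :
  0 <= r -> 0 <= d -> 0 <= s -> 0 < e -> 0 < r + e + s * (d + e).
Proof.
move=> r0 d0 s0 e0; apply: ltr_pwDl; first exact: ltr_wpDl.
by apply: mulr_ge0 => //; apply: addr_ge0 => //; exact: ltW.
Qed.

Lemma div_shift_antitone (R : realType) (k r d s e e' : R) :
  0 <= k -> 0 <= r -> 0 <= d -> 0 <= s -> 0 < e -> e <= e' ->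
  k / (r + e' + s * (d + e')) <= k / (r + e + s * (d + e)).
Proof.
move=> k0 r0 d0 s0 e0 ee; rewrite ler_wpM2l // lef_pV2 ?posrE.
- by rewrite lerD ?lerD2l // ler_wpM2l // lerD2l.
- exact: pencil_shift_gt0 (lt_le_trans e0 ee).
- exact: pencil_shift_gt0.
Qed.

Lemma cvg_equot_pencil (R : realType) (k r d s : R) :
  0 <= k -> 0 <= r -> 0 <= d -> 0 <= s ->
  (k / (r + e + s * (d + e)))%:E @[e --> 0^'+] --> equot k (r + s * d).
Proof.
move=> k0 r0 d0 s0; have id0 := @cvg_at_right0_id R.
apply: cvg_equot => //; first exact: cvg_cst.
- rewrite -[r in X in _ --> X]addr0 -[d in X in _ --> X]addr0.
  by apply: cvgD; [apply: cvgD|apply: cvgM; [|apply: cvgD]] => //; exact: cvg_cst.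
- by move=> e; exact: pencil_shift_gt0.
Qed.

Lemma measurable_equot_pencil (R : realType) (k r d : R) :
  0 <= k -> 0 <= r -> 0 <= d ->
  measurable_fun (`[0, +oo[ : set (measurableTypeR R)) (fun s => equot k (r + s * d)).
Proof.
move=> k0 r0 d0.
apply: (emeasurable_fun_cvg (fun n (s : measurableTypeR R) =>
  (k / (r + harmonic n + (s : R) * (d + harmonic n)))%:E)).
  move=> n; apply: measurable_div_affine => //.
    by rewrite ltr_wpDl // harmonic_gt0.
  by rewrite addr_ge0 // harmonic_ge0.
move=> s /mem_itv0y s0.
exact: (cvg_harmonic_comp (cvg_equot_pencil k0 r0 d0 s0)).
Qed.

(** Monotone convergence: the denominators decrease with [m], so the nonnegative integrands increase
    to their [equot] limits. *)
Lemma cvg_integral_pencil (R : realType) n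
    (lam : {measure set (measurableTypeR R) -> \bar R}) (k r d : 'I_n -> R) :
  (forall i, 0 <= k i) -> (forall i, 0 <= r i) -> (forall i, 0 <= d i) ->
  (\int[lam]_(s in `[0%R, +oo[)
     (\sum_i k i / (r i + harmonic m + s * (d i + harmonic m)))%:E)%E @[m --> \oo]
  --> (\int[lam]_(s in `[0%R, +oo[) (\sum_i equot (k i) (r i + s * d i)))%E.
Proof.
move=> k0 r0 d0.
have cvg_s s : 0 <= s ->
    (\sum_i k i / (r i + harmonic m + s * (d i + harmonic m)))%:E @[m --> \oo]
    --> (\sum_i equot (k i) (r i + s * d i))%E.
  move=> s0; under eq_fun do rewrite -sumEFin.
  apply: cvg_nnesum => [i _|i _].
    apply: nearW => m; rewrite lee_fin divr_ge0 //.
    by rewrite addr_ge0 ?mulr_ge0 // addr_ge0 // harmonic_ge0.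
  exact: (cvg_harmonic_comp (cvg_equot_pencil (k0 i) (r0 i) (d0 i) s0)).
rewrite [X in _ --> X](eq_integral (fun s : measurableTypeR R => limn (fun m =>
  (\sum_i k i / (r i + harmonic m + (s : R) * (d i + harmonic m)))%:E))); last first.
  by move=> s /set_mem /mem_itv0y s0; apply/esym/cvg_lim => //; exact: cvg_s.
apply: cvg_monotone_convergence => //.
- move=> m.
  have mS : measurable_fun (`[0, +oo[ : set (measurableTypeR R))
      (fun s : measurableTypeR R => (\sum_i (k i / (r i + harmonic m
         + (s : R) * (d i + harmonic m)))%:E)%E).
    apply: emeasurable_sum => i; apply: measurable_div_affine => //.
      by rewrite ltr_wpDl // harmonic_gt0.
    by rewrite addr_ge0 // harmonic_ge0.
  by apply: eq_measurable_fun mS => s _; rewrite sumEFin.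
- move=> m s /mem_itv0y s0; rewrite lee_fin sumr_ge0 // => i _.
  by rewrite divr_ge0 // addr_ge0 ?mulr_ge0 // addr_ge0 // harmonic_ge0.
- move=> s /mem_itv0y s0 m p mp; rewrite lee_fin ler_sum // => i _.
  apply: div_shift_antitone => //; first exact: harmonic_gt0.
  by rewrite lef_pV2 ?posrE // ler_nat.
Qed.

(** What remains of the regularized divergence of two states of equal trace once the trace term with
    coefficient f(1) is removed. *)
Definition shift_div (R : realType) n (c : R)
    (lam : {measure set (measurableTypeR R) -> \bar R}) (P S : 'M[R[i]]_n) (e : R)
    : \bar R :=
  ((c * chi2_div (addeps P e) (addeps S e))%:E
   + \int[lam]_(s in `[0%R, +oo[) (pencil_div (addeps P e) (addeps S e) s)%:E)%E.

Lemma addeps_udiag (R : realType) n (T : 'M[R[i]]_n) (a : 'I_n -> R) (e : R) :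
  T \is unitarymx -> addeps (udiag T a) e = udiag T (fun i => a i + e).
Proof. by move=> uT; rewrite /addeps -(udiag_scalar e uT) udiagD. Qed.

Lemma rtr_addeps (R : realType) n (A : 'M[R[i]]_n) (e : R) :
  rtr (addeps A e) = rtr A + e * n%:R.
Proof.
rewrite rtrD -(udiag_scalar e (unitarymx1 R n)) rtr_udiag ?unitarymx1 //.
by rewrite sumr_const card_ord mulr_natr.
Qed.

Lemma posdef_addeps (R : realType) n (A : 'M[R[i]]_n) (e : R) :
  psd A -> 0 < e -> posdef (addeps A e).
Proof.
move=> pA e0; rewrite /addeps addrC; apply: posdefD => //.
rewrite -(udiag_scalar e (unitarymx1 R n)).
exact/(posdef_udiag _ (unitarymx1 R n)).
Qed.

Lemma addepsB (R : realType) n (A B : 'M[R[i]]_n) (e : R) :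
  addeps A e - addeps B e = A - B.
Proof. by rewrite /addeps opprD addrACA subrr addr0. Qed.

Lemma addeps_pencil (R : realType) n (A B : 'M[R[i]]_n) (e s : R) :
  addeps A e + s%:C *: addeps B e = addeps (A + s%:C *: B) ((1 + s) * e).
Proof.
rewrite /addeps scalerDr addrACA scale_scalar_mx.
have -> : ((1 + s) * e)%:C = e%:C + s%:C * e%:C.
  by rewrite mulrDl mul1r rmorphD rmorphM.
by rewrite [X in _ = _ + X]raddfD.
Qed.

(** The shift cancels in P - S. It adds [e] to the denominator of the quadratic term and
    [(1 + s) * e] to that of the pencil, so both resolvent traces are antitone in [e]. *)
Lemma shift_div_antitone (R : realType) n (f : R -> R) (c : R)
    (lam : {measure set (measurableTypeR R) -> \bar R}) (P S : 'M[R[i]]_n)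
    (e e' : R) :
  opconv_repr f c lam -> psd P -> psd S -> rtr P = rtr S -> 0 < e -> e <= e' ->
  (shift_div c lam P S e' <= shift_div c lam P S e)%E.
Proof.
move=> fr pP pS trPS e0 ee'; have e'0 := lt_le_trans e0 ee'.
have trE x : rtr (addeps P x) = rtr (addeps S x) by rewrite !rtr_addeps trPS.
have [_ q0 mq _] := maxdiv_pd_integral fr (posdef_addeps pP e0) (posdef_addeps pS e0) (trE e).
have [_ q'0 mq' _] :=
  maxdiv_pd_integral fr (posdef_addeps pP e'0) (posdef_addeps pS e'0) (trE e').
have [c0 _ _] := fr; have hD := hermB (proj1 pP) (proj1 pS).
apply: leeD.
  rewrite lee_fin ler_wpM2l // /chi2_div !addepsB.
  exact: rtr_resolvent_antitone pS hD e0 ee'.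
apply: ge0_le_integral mq' mq _ => // s /mem_itv0y s0; rewrite lee_fin; first exact: q'0.
rewrite /pencil_div !addepsB !addeps_pencil.
apply: rtr_resolvent_antitone hD _ _; first exact: psdD (psdZ s0 pS).
  by rewrite mulr_gt0 // ltr_wpDr.
by rewrite ler_wpM2l // addr_ge0.
Qed.

Lemma shift_div_is_cvg (R : realType) n (f : R -> R) (c : R)
    (lam : {measure set (measurableTypeR R) -> \bar R}) (P S : 'M[R[i]]_n) :
  opconv_repr f c lam -> psd P -> psd S -> rtr P = rtr S ->
  cvg (shift_div c lam P S e @[e --> 0^'+]).
Proof.
move=> fr pP pS trPS; apply: nonincreasing_at_right_is_cvge.
apply: nearW => x a b; rewrite !in_itv /= => /andP[a0 _] /andP[b0 _] ab.
exact: (shift_div_antitone fr pP pS trPS a0 ab).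
Qed.

Lemma maxdiv_pd_addeps (R : realType) n (f : R -> R) (c : R)
    (lam : {measure set (measurableTypeR R) -> \bar R}) (P S : 'M[R[i]]_n) (e : R) :
  opconv_repr f c lam -> psd P -> psd S -> rtr P = rtr S -> 0 < e ->
  (maxdiv_pd f (addeps P e) (addeps S e))%:E =
    ((f 1 * (rtr S + e * n%:R))%:E + shift_div c lam P S e)%E.
Proof.
move=> fr pP pS trPS e0.
have trE : rtr (addeps P e) = rtr (addeps S e) by rewrite !rtr_addeps trPS.
have [_ _ _ ->] := maxdiv_pd_integral fr (posdef_addeps pP e0) (posdef_addeps pS e0) trE.
by rewrite rtr_addeps.
Qed.

Lemma maxdiv_shift_div (R : realType) n (f : R -> R) (c : R)
    (lam : {measure set (measurableTypeR R) -> \bar R}) (P S : 'M[R[i]]_n) :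
  opconv_repr f c lam -> psd P -> psd S -> rtr P = 1 -> rtr S = 1 ->
  maxdiv f P S = ((f 1)%:E + lim (shift_div c lam P S e @[e --> 0^'+]))%E.
Proof.
move=> fr pP pS trP trS; have trPS : rtr P = rtr S by rewrite trP trS.
have Hc := shift_div_is_cvg fr pP pS trPS.
apply/cvg_lim => //.
have H0 : (fun e : R => f 1 * (rtr S + e * n%:R)) @ 0^'+ --> f 1.
  rewrite [X in _ --> X](_ : _ = f 1 * (rtr S + 0 * n%:R)); last first.
    by rewrite trS mul0r addr0 mulr1.
  apply: cvgM (cvg_cst _) (cvgD (cvg_cst _) (cvgM _ (cvg_cst _))).
  exact: cvg_at_right0_id.
have H : (f 1 * (rtr S + e * n%:R))%:E @[e --> 0^'+] --> (f 1)%:E.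
  by apply: cvg_EFin; [exact: nearW|exact: H0].
(* The limit may be [+oo]; the sum is still defined because the other summand is finite. *)
have Hd : ((f 1)%:E +? lim (shift_div c lam P S e @[e --> 0^'+]))%E.
  by rewrite fin_num_adde_defr.
apply: cvg_trans (cvgeD Hd H Hc).
apply: near_eq_cvg; near=> e.
by rewrite /= (maxdiv_pd_addeps fr pP pS trPS).
Unshelve. all: by end_near. Qed.

(** * Commuting pairs: comparison, limit and closed formula *)

Lemma chi2_div_comm (R : realType) n (T : 'M[R[i]]_n) (r d : 'I_n -> R) :
  T \is unitarymx -> (forall i, 0 < d i) ->
  chi2_div (udiag T r) (udiag T d) = \sum_i (r i - d i) ^+ 2 / d i.
Proof.
move=> uT d0; rewrite /chi2_div udiagN udiagD.
have [_ ->] := udiagV uT (fun i => lt0r_neq0 (d0 i)).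
rewrite !(udiagM _ _ uT) (rtr_udiag _ uT).
by apply: eq_bigr => i _; rewrite expr2 mulrAC.
Qed.

Lemma pencil_div_comm (R : realType) n (T : 'M[R[i]]_n) (r d : 'I_n -> R) (s : R) :
  T \is unitarymx -> (forall i, 0 < r i) -> (forall i, 0 < d i) -> 0 <= s ->
  pencil_div (udiag T r) (udiag T d) s = \sum_i (r i - d i) ^+ 2 / (r i + s * d i).
Proof.
move=> uT r0 d0 s0; rewrite /pencil_div udiagN udiagZ !udiagD.
have m0 i : r i + s * d i != 0 by rewrite gt_eqF // ltr_wpDr // mulr_ge0 // ltW.
have [_ ->] := udiagV uT m0.
rewrite !(udiagM _ _ uT) (rtr_udiag _ uT).
by apply: eq_bigr => i _; rewrite expr2 mulrAC.
Qed.

(** The comparison is made before the limit: a common shift by [e] preserves both orders and makes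
    both spectra strictly positive, so the bounds for positive definite pairs apply to each
    integrand. *)
Lemma shift_div_le (R : realType) n (f : R -> R) (c : R)
    (lam : {measure set (measurableTypeR R) -> \bar R})
    (V Y T : 'M[R[i]]_n) (r d : 'I_n -> R) (e : R) :
  opconv_repr f c lam ->
  V \is unitarymx -> Y \is unitarymx -> T \is unitarymx ->
  (forall i j : 'I_n, (i <= j)%N -> r j <= r i) ->
  (forall i j : 'I_n, (i <= j)%N -> d i <= d j) ->
  (forall i, 0 <= r i) -> (forall i, 0 <= d i) ->
  \sum_i r i = \sum_i d i -> 0 < e ->
  (shift_div c lam (udiag V r) (udiag Y d) e
    <= shift_div c lam (udiag T r) (udiag T d) e)%E.
Proof.
move=> fr uV uY uT r_dec d_inc r0 d0 rd e0; have [c0 _ _] := fr.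
have re0 i : 0 < r i + e by rewrite ltr_wpDl.
have de0 i : 0 < d i + e by rewrite ltr_wpDl.
have re_dec (i j : 'I_n) : (i <= j)%N -> r j + e <= r i + e.
  by move=> ij; rewrite lerD2r r_dec.
have de_inc (i j : 'I_n) : (i <= j)%N -> d i + e <= d j + e.
  by move=> ij; rewrite lerD2r d_inc.
have rE U : U \is unitarymx -> addeps (udiag U r) e = udiag U (fun i => r i + e).
  exact: addeps_udiag.
have dE U : U \is unitarymx -> addeps (udiag U d) e = udiag U (fun i => d i + e).
  exact: addeps_udiag.
have pr U : U \is unitarymx -> posdef (udiag U (fun i => r i + e)).
  by move=> uU; apply/(posdef_udiag _ uU).
have pd U : U \is unitarymx -> posdef (udiag U (fun i => d i + e)).
  by move=> uU; apply/(posdef_udiag _ uU).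
have trE U U' : U \is unitarymx -> U' \is unitarymx ->
    rtr (udiag U (fun i => r i + e)) = rtr (udiag U' (fun i => d i + e)).
  by move=> uU uU'; rewrite (rtr_udiag _ uU) (rtr_udiag _ uU') !big_split /= rd.
have [_ q0 mq _] := maxdiv_pd_integral fr (pr _ uV) (pd _ uY) (trE _ _ uV uY).
have [_ _ mq' _] := maxdiv_pd_integral fr (pr _ uT) (pd _ uT) (trE _ _ uT uT).
rewrite /shift_div (rE _ uV) (dE _ uY) (rE _ uT) (dE _ uT); apply: leeD.
  rewrite lee_fin (chi2_div_comm _ uT de0); apply: ler_wpM2l c0 _ _ _.
  exact: (chi2_div_le uV uY re_dec de_inc re0 de0).
apply: ge0_le_integral mq mq' _ => // s /mem_itv0y s0; rewrite lee_fin; first exact: q0.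
rewrite (pencil_div_comm uT re0 de0 s0).
exact: (pencil_div_le uV uY re_dec de_inc re0 de0 s0).
Qed.

Lemma equot_fin (R : realType) (x y : R) : y != 0 -> equot x y = (x / y)%:E.
Proof.
by move=> y0; rewrite /equot (negPf y0); case: eqP => [->|//]; rewrite mul0r.
Qed.

(** The identity (r - d)^2 = r^2 - 2 r d + d^2 over a common denominator, stated without subtraction
    so that it holds for infinite values too. *)
Lemma equot_sqrB (R : realType) (r d y : R) : (y = 0 -> r = 0) ->
  (equot ((r - d) ^+ 2) y + 2%:E * equot (r * d) y
    = equot (r ^+ 2) y + equot (d ^+ 2) y)%E.
Proof.
have [-> /(_ erefl) ->|y0 _] := eqVneq y 0.
  by rewrite mul0r sub0r sqrrN expr0n /= /equot eqxx mule0 adde0 add0e.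
rewrite !equot_fin // -EFinM -!EFinD; congr EFin.
by field.
Qed.

Lemma equot_sqrB_den (R : realType) (r d : R) :
  (equot (r ^+ 2) d + d%:E = equot ((r - d) ^+ 2) d + (2 * r)%:E)%E.
Proof.
have [->|d0] := eqVneq d 0.
  rewrite subr0 adde0 /equot eqxx; case: eqP => [|//] /eqP.
  by rewrite expf_eq0 /= => /eqP ->; rewrite mulr0 adde0.
by rewrite !equot_fin // -!EFinD; congr EFin; field.
Qed.

(** The pair [x], [y] represents the same quotients with inner inverses cleared: [a e i] and [b e i]
    may both blow up as [e] decreases, while [x e i] and [y e i] have finite limits. *)
Lemma tr_frac_udiag (R : realType) n (T : 'M[R[i]]_n) (A B : R -> 'M[R[i]]_n)
    (a b x y : R -> 'I_n -> R) (x0 y0 : 'I_n -> R) :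
  T \is unitarymx ->
  (forall e, 0 < e -> A e = udiag T (a e) /\ B e = udiag T (b e)) ->
  (forall e i, 0 < e -> 0 < b e i + e /\ a e i / (b e i + e) = x e i / y e i) ->
  (forall e i, 0 < e -> 0 < y e i) -> (forall e i, 0 < e -> 0 <= x e i) ->
  (forall i, x ^~ i @ 0^'+ --> x0 i) -> (forall i, y ^~ i @ 0^'+ --> y0 i) ->
  (forall i, 0 <= x0 i) -> (forall i, x0 i = 0 -> y0 i = 0 -> forall e, x e i = 0) ->
  tr_frac A B = (\sum_i equot (x0 i) (y0 i))%E.
Proof.
move=> uT AB abE ypos xge0 cx cy x00 xy0; apply/cvg_lim => //.
suff H : (\sum_i (x e i / y e i)%:E)%E @[e --> 0^'+] --> (\sum_i equot (x0 i) (y0 i))%E.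
  apply: cvg_trans H; apply: near_eq_cvg; near=> e.
  have e0 : 0 < e by [].
  have [-> ->] := AB e e0; rewrite (addeps_udiag _ _ uT).
  have [_ ->] := udiagV uT (fun i => lt0r_neq0 (proj1 (abE e i e0))).
  rewrite (udiagM _ _ uT) (rtr_udiag _ uT) -sumEFin.
  by apply: eq_bigr => i _; rewrite -(proj2 (abE e i e0)).
apply: cvg_nnesum => i _.
  by near=> e; rewrite lee_fin divr_ge0 // ?xge0 // ltW // ypos.
by apply: cvg_equot => //; [move=> e e0; exact: ypos|exact: xy0].
Unshelve. all: by end_near. Qed.

Lemma cvg_pencil_den (R : realType) (r d s : R) :
  r + (s + e) * (d + e) @[e --> 0^'+] --> r + s * d.
Proof.
have id0 := @cvg_at_right0_id R.
rewrite -[s in X in _ --> X]addr0 -[d in X in _ --> X]addr0.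
exact: cvgD (cvg_cst _) (cvgM (cvgD (cvg_cst _) id0) (cvgD (cvg_cst _) id0)).
Qed.

Lemma tr_frac_pencil (R : realType) n (T : 'M[R[i]]_n) (r d : 'I_n -> R) (s : R) :
  T \is unitarymx -> (forall i, 0 <= r i) -> (forall i, 0 <= d i) -> 0 <= s ->
  let Rm := udiag T r in let D := udiag T d in
  let Dinv e := invmx (addeps D e) in
  let den e := addeps (Dinv e *m Rm) s in
  [/\ tr_frac (fun=> Rm *m Rm) (fun=> D) = (\sum_i equot (r i ^+ 2) (d i))%E,
      tr_frac (fun e => Dinv e *m (Rm *m Rm)) den
        = (\sum_i equot (r i ^+ 2) (r i + s * d i))%E,
      tr_frac (fun=> Rm) den = (\sum_i equot (r i * d i) (r i + s * d i))%E
    & tr_frac (fun=> D) den = (\sum_i equot (d i ^+ 2) (r i + s * d i))%E].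
Proof.
move=> uT r0 d0 s0 Rm D Dinv den.
have id0 := @cvg_at_right0_id R.
have de0 e i : 0 < e -> 0 < d i + e by move=> e0; rewrite ltr_wpDl.
have DinvE e : 0 < e -> Dinv e = udiag T (fun i => (d i + e)^-1).
  move=> e0; rewrite /Dinv /D (addeps_udiag _ _ uT).
  by have [_ ->] := udiagV uT (fun i => lt0r_neq0 (de0 e i e0)).
have denE e : 0 < e -> den e = udiag T (fun i => (d i + e)^-1 * r i + s).
  by move=> e0; rewrite /den (DinvE e e0) /Rm (udiagM _ _ uT) (addeps_udiag _ _ uT).
have den0 e i : 0 < e -> 0 < (d i + e)^-1 * r i + s + e.
  move=> e0; rewrite ltr_wpDl // addr_ge0 // mulr_ge0 // invr_ge0 ltW //.
  exact: de0.
(* The denominator after multiplication by [d i + e]. It differs from the regularized pencil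
   [r i + e + s * (d i + e)] but has the same limit [r i + s * d i]. *)
pose y e i := r i + (s + e) * (d i + e).
have y0 e i : 0 < e -> 0 < y e i.
  by move=> e0; rewrite ltr_wpDl // mulr_gt0 ?de0 // ltr_wpDl.
have cy i : y ^~ i @ 0^'+ --> r i + s * d i by exact: cvg_pencil_den.
have yE e i : 0 < e -> (d i + e)^-1 * r i + s + e = y e i / (d i + e).
  by move=> e0; rewrite /y; field; rewrite gt_eqF // de0.
split.
- apply: (tr_frac_udiag (a := fun _ i => r i ^+ 2) (b := fun=> d)
    (x := fun _ i => r i ^+ 2) (y := fun e i => d i + e) uT) => //.
  + by move=> e e0; split=> //; rewrite /Rm (udiagM _ _ uT).
  + by move=> e i e0; split=> //; exact: de0.
  + by move=> e i _; exact: sqr_ge0.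
  + by move=> i; exact: cvg_cst.
  + by move=> i; rewrite -[d i in X in _ --> X]addr0; exact: cvgD (cvg_cst _) id0.
  + by move=> i; exact: sqr_ge0.
- apply: (tr_frac_udiag (a := fun e i => (d i + e)^-1 * r i ^+ 2)
    (b := fun e i => (d i + e)^-1 * r i + s)
    (x := fun _ i => r i ^+ 2) (y := y) uT) => //.
  + move=> e e0; split; last exact: denE.
    by rewrite (DinvE e e0) /Rm !(udiagM _ _ uT).
  + move=> e i e0; split; first exact: den0.
    by rewrite (yE e i e0); field; rewrite !gt_eqF ?de0 ?y0.
  + by move=> e i _; exact: sqr_ge0.
  + by move=> i; exact: cvg_cst.
  + by move=> i; exact: sqr_ge0.
- apply: (tr_frac_udiag (a := fun=> r) (b := fun e i => (d i + e)^-1 * r i + s)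
    (x := fun e i => r i * (d i + e)) (y := y) uT) => //.
  + by move=> e e0; split=> //; exact: denE.
  + move=> e i e0; split; first exact: den0.
    by rewrite (yE e i e0); field; rewrite !gt_eqF ?de0 ?y0.
  + by move=> e i e0; rewrite mulr_ge0 // ltW // de0.
  + move=> i; rewrite -[d i in X in _ --> X]addr0.
    exact: cvgM (cvg_cst _) (cvgD (cvg_cst _) id0).
  + by move=> i; rewrite mulr_ge0.
  + move=> i _ /eqP; rewrite paddr_eq0 ?mulr_ge0 // => /andP[/eqP -> _] e.
    by rewrite mul0r.
- apply: (tr_frac_udiag (a := fun=> d) (b := fun e i => (d i + e)^-1 * r i + s)
    (x := fun e i => d i * (d i + e)) (y := y) uT) => //.
  + by move=> e e0; split=> //; exact: denE.
  + move=> e i e0; split; first exact: den0.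
    by rewrite (yE e i e0); field; rewrite !gt_eqF ?de0 ?y0.
  + by move=> e i e0; rewrite mulr_ge0 // ltW // de0.
  + move=> i; rewrite [X in _ --> X](_ : _ = d i * (d i + 0)); last by rewrite addr0 expr2.
    exact: cvgM (cvg_cst _) (cvgD (cvg_cst _) id0).
  + by move=> i; exact: sqr_ge0.
  + move=> i /eqP; rewrite expf_eq0 /= => /eqP -> _ e.
    by rewrite mul0r.
Qed.

Lemma sum_equot_ge0 (R : realType) n (k y : 'I_n -> R) :
  (forall i, 0 <= k i) -> (forall i, 0 <= y i) -> (0 <= \sum_i equot (k i) (y i))%E.
Proof. by move=> k0 y0; apply: sume_ge0 => i _; exact: equot_ge0. Qed.

Lemma pencil_ge0 (R : realType) (r d s : R) :
  0 <= r -> 0 <= d -> 0 <= s -> 0 <= r + s * d.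
Proof. by move=> r0 d0 s0; rewrite addr_ge0 // mulr_ge0. Qed.

Lemma cvg_sum_quot (R : realType) n (k d : 'I_n -> R) :
  (forall i, 0 <= k i) -> (forall i, 0 <= d i) ->
  (\sum_i (k i / (d i + e))%:E)%E @[e --> 0^'+] --> (\sum_i equot (k i) (d i))%E.
Proof.
move=> k0 d0; apply: cvg_nnesum => i _.
  by near=> e; rewrite lee_fin divr_ge0 // addr_ge0.
apply: cvg_equot => //.
- exact: cvg_cst.
- by rewrite -[d i in X in _ --> X]addr0; exact: cvgD (cvg_cst _) (@cvg_at_right0_id R).
- by move=> e e0; rewrite ltr_wpDl.
Unshelve. all: by end_near. Qed.

(** Cross-multiplying leaves [r ^+ 2 + s * d ^+ 2 >= 0]. The bound is a multiple of [(1 + s)^-1],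
    whose integral is finite by the condition on the representing measure. *)
Lemma equot_mul_le (R : realType) (r d s : R) : 0 <= r -> 0 <= d -> 0 <= s ->
  (equot (r * d) (r + s * d) <= ((r + d) * (1 + s)^-1)%:E)%E.
Proof.
move=> r0 d0 s0; have s10 : 0 < 1 + s by rewrite ltr_pwDl.
have sd0 : 0 <= s * d by rewrite mulr_ge0.
have [y0|y0] := eqVneq (r + s * d) 0.
  have : r == 0 by move/eqP: y0; rewrite paddr_eq0 // => /andP[].
  by move=> /eqP ->; rewrite mul0r /equot eqxx lee_fin !(add0r, divr_ge0) // ltW.
have yp : 0 < r + s * d by rewrite lt_neqAle eq_sym y0 addr_ge0.
rewrite equot_fin // lee_fin ler_pdivrMr // mulrAC ler_pdivlMr //.
have := mulr_ge0 r0 r0; have := mulr_ge0 sd0 d0; lra.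
Qed.

Lemma cvg_shift_div_comm (R : realType) n (f : R -> R) (c : R)
    (lam : {measure set (measurableTypeR R) -> \bar R})
    (T : 'M[R[i]]_n) (r d : 'I_n -> R) :
  opconv_repr f c lam -> T \is unitarymx ->
  (forall i, 0 <= r i) -> (forall i, 0 <= d i) -> \sum_i r i = \sum_i d i ->
  lim (shift_div c lam (udiag T r) (udiag T d) e @[e --> 0^'+]) =
    (c%:E * (\sum_i equot ((r i - d i) ^+ 2) (d i))
     + \int[lam]_(s in `[0%R, +oo[)
         (\sum_i equot ((r i - d i) ^+ 2) (r i + s * d i)))%E.
Proof.
move=> fr uT r0 d0 rd; have [c0 _ _] := fr.
have pr : psd (udiag T r) by apply/(psd_udiag _ uT).
have pd : psd (udiag T d) by apply/(psd_udiag _ uT).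
have tr : rtr (udiag T r) = rtr (udiag T d) by rewrite !(rtr_udiag _ uT).
have Hc := cvg_harmonic_comp (shift_div_is_cvg fr pr pd tr).
(* The limit from the right is known to exist, so it suffices to identify it along the harmonic
   sequence. *)
apply: (cvg_unique (@ereal_hausdorff R) Hc) => {Hc}; rewrite /mkset; clear tr pd pr.
have hE m : shift_div c lam (udiag T r) (udiag T d) (harmonic m) =
    (c%:E * \sum_i ((r i - d i) ^+ 2 / (d i + harmonic m))%:E
    + \int[lam]_(s in `[0%R, +oo[) (\sum_i (r i - d i) ^+ 2
        / (r i + harmonic m + s * (d i + harmonic m)))%:E)%E.
  have h0 : 0 < harmonic m :> R by exact: harmonic_gt0.
  have rh i : 0 < r i + harmonic m by rewrite ltr_wpDl.
  have dh i : 0 < d i + harmonic m by rewrite ltr_wpDl.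
  have BE i : r i + harmonic m - (d i + harmonic m) = r i - d i by ring.
  rewrite /shift_div !(addeps_udiag _ _ uT) (chi2_div_comm _ uT dh).
  rewrite sumEFin -EFinM; congr (_ + _)%E.
    by congr (_ * _)%:E; apply: eq_bigr => i _; rewrite BE.
  apply: eq_integral => s /set_mem /mem_itv0y s0.
  rewrite (pencil_div_comm uT rh dh s0); congr EFin.
  by apply: eq_bigr => i _; rewrite BE.
under eq_fun do rewrite hE.
have q0 i : 0 <= (r i - d i) ^+ 2 by exact: sqr_ge0.
apply: cvgeD.
- apply: ge0_adde_def; rewrite inE.
    by apply: mule_ge0; [exact: c0|exact: sum_equot_ge0].
  apply: integral_ge0 => s /mem_itv0y s0; apply: (sum_equot_ge0 q0) => i.
  exact: pencil_ge0.
- by apply: cvgeZl; [|exact: (cvg_harmonic_comp (cvg_sum_quot q0 d0))].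
- exact: cvg_integral_pencil.
Qed.

Lemma maxdiv_diag_equot (R : realType) n (f : R -> R) (c : R)
    (lam : {measure set (measurableTypeR R) -> \bar R})
    (T : 'M[R[i]]_n) (r d : 'I_n -> R) :
  T \is unitarymx -> (forall i, 0 <= r i) -> (forall i, 0 <= d i) ->
  maxdiv_diag f c lam (udiag T r) (udiag T d) =
    ((f 1)%:E + c%:E * ((\sum_i equot (r i ^+ 2) (d i)) - 1)
    + \int[lam]_(s in `[0%R, +oo[) (\sum_i equot (r i ^+ 2) (r i + s * d i))
    - 2%:E * \int[lam]_(s in `[0%R, +oo[) (\sum_i equot (r i * d i) (r i + s * d i))
    + \int[lam]_(s in `[0%R, +oo[) (\sum_i equot (d i ^+ 2) (r i + s * d i)))%E.
Proof.
move=> uT r0 d0; rewrite /maxdiv_diag.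
have [-> _ _ _] := tr_frac_pencil uT r0 d0 (lexx 0).
congr (_ + _ + _ - _ * _ + _)%E.
- apply: eq_integral => s /set_mem /mem_itv0y s0.
  by have [_ H _ _] := tr_frac_pencil uT r0 d0 s0; exact: H.
- apply: eq_integral => s /set_mem /mem_itv0y s0.
  by have [_ _ H _] := tr_frac_pencil uT r0 d0 s0; exact: H.
- apply: eq_integral => s /set_mem /mem_itv0y s0.
  by have [_ _ _ H] := tr_frac_pencil uT r0 d0 s0; exact: H.
Qed.

(** The five terms of the formula recombine into the quadratic and pencil terms of the commuting
    divergence. The only subtracted integral is finite, so no indeterminate difference arises. *)
Lemma maxdiv_diag_udiag (R : realType) n (f : R -> R) (c : R)
    (lam : {measure set (measurableTypeR R) -> \bar R})
    (T : 'M[R[i]]_n) (r d : 'I_n -> R) :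
  opconv_repr f c lam -> T \is unitarymx ->
  (forall i, 0 <= r i) -> (forall i, 0 <= d i) ->
  \sum_i r i = 1 -> \sum_i d i = 1 ->
  maxdiv_diag f c lam (udiag T r) (udiag T d) =
    ((f 1)%:E + (c%:E * (\sum_i equot ((r i - d i) ^+ 2) (d i))
     + \int[lam]_(s in `[0%R, +oo[)
         (\sum_i equot ((r i - d i) ^+ 2) (r i + s * d i))))%E.
Proof.
move=> [c0 lam_fin _] uT r0 d0 r1 d1; rewrite maxdiv_diag_equot //; clear T uT.
have mI k : (forall i, 0 <= k i) -> measurable_fun (`[0, +oo[ : set (measurableTypeR R))
    (fun s => \sum_i equot (k i) (r i + s * d i))%E.
  by move=> k0; apply: emeasurable_sum => i; exact: measurable_equot_pencil.
have gI (k : 'I_n -> R) s : (forall i, 0 <= k i) -> 0 <= s ->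
    (0 <= \sum_i equot (k i) (r i + s * d i))%E.
  by move=> k0 s0; apply: (sum_equot_ge0 k0) => i; exact: pencil_ge0.
have rd0 i : 0 <= r i * d i by rewrite mulr_ge0.
set I3 := (X in (_ + X - _ + _)%E); set I4 := (X in (_ - 2%:E * X)%E).
set I5 := (X in (_ - _ + X)%E); set I := (X in (_ = _ + (_ + X))%E).
have sq0 (a : 'I_n -> R) i : 0 <= a i ^+ 2 by exact: sqr_ge0.
have II : (I + 2%:E * I4 = I3 + I5)%E.
  rewrite -ge0_integralZl_EFin //; last first.
  - exact: mI.
  - by move=> s /mem_itv0y s0; exact: gI.
  rewrite -!ge0_integralD //.
  - apply: eq_integral => s /set_mem /mem_itv0y s0.
    rewrite ge0_sume_distrr; last first.
      by move=> i _; apply: equot_ge0; [exact: rd0|exact: pencil_ge0].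
    rewrite -!big_split; apply: eq_bigr => i _; apply: equot_sqrB => /eqP.
    by rewrite paddr_eq0 ?mulr_ge0 // => /andP[/eqP].
  - by move=> s /mem_itv0y s0; apply: gI => // i; exact: sqr_ge0.
  - by apply: mI => i; exact: sqr_ge0.
  - by move=> s /mem_itv0y s0; apply: gI => // i; exact: sqr_ge0.
  - by apply: mI => i; exact: sqr_ge0.
  - by move=> s /mem_itv0y s0; apply: gI => // i; exact: sqr_ge0.
  - by apply: mI => i; exact: sqr_ge0.
  - by move=> s /mem_itv0y s0; apply: mule_ge0; [|exact: gI].
  - by apply: measurable_funeM; exact: mI.
have I4_fin : (I4 < +oo)%E.
  have K0 : 0 <= \sum_i (r i + d i) by rewrite sumr_ge0 // => i _; rewrite addr_ge0.
  have V0 (s : R) : (`[0%R, +oo[%classic : set R) s -> (0 <= ((1 + s)^-1)%:E)%E.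
    by move=> /mem_itv0y s0; rewrite lee_fin invr_ge0 addr_ge0.
  have mV : measurable_fun (`[0, +oo[ : set (measurableTypeR R))
      (fun s : measurableTypeR R => ((1 + (s : R))^-1)%:E).
    have := measurable_div_affine (@ler01 R) (@ltr01 R) (@ler01 R).
    by apply: eq_measurable_fun => s _; rewrite div1r mulr1.
  apply: (@le_lt_trans _ _ ((\sum_i (r i + d i))%:E *
      \int[lam]_(s in `[0%R, +oo[) ((1 + s)^-1)%:E)%E); last first.
    by rewrite lte_mul_pinfty // lee_fin.
  rewrite -ge0_integralZl_EFin //.
  apply: ge0_le_integral => //.
  - by move=> s /mem_itv0y s0; exact: gI.
  - exact: mI.
  - exact: measurable_funeM.
  - move=> s /mem_itv0y s0; rewrite -EFinM mulr_suml -sumEFin.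
    by apply: lee_sum => i _; exact: equot_mul_le.
have I0 : (0 <= I)%E.
  by apply: integral_ge0 => s /mem_itv0y s0; apply: gI => // i; exact: sqr_ge0.
have I30 : (0 <= I3)%E.
  by apply: integral_ge0 => s /mem_itv0y s0; apply: gI => // i; exact: sqr_ge0.
have I40 : (0 <= I4)%E by apply: integral_ge0 => s /mem_itv0y s0; exact: gI.
have I50 : (0 <= I5)%E.
  by apply: integral_ge0 => s /mem_itv0y s0; apply: gI => // i; exact: sqr_ge0.
(* Both spectra sum to 1: adding 1 on the left and 2 on the right balances the summed identity,
   whose infinite values occur on both sides together. *)
have -> : (\sum_i equot (r i ^+ 2) (d i) - 1 = \sum_i equot ((r i - d i) ^+ 2) (d i))%E.
  have : (\sum_i equot (r i ^+ 2) (d i) + \sum_i (d i)%:E =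
          \sum_i equot ((r i - d i) ^+ 2) (d i) + \sum_i (2 * r i)%:E)%E.
    by rewrite -!big_split; apply: eq_bigr => i _; exact: equot_sqrB_den.
  rewrite !sumEFin -mulr_sumr d1 r1 mulr1.
  case: (\sum_i _)%E => [a| |]; case: (\sum_i _)%E => [b| |] //.
  by move=> [ab]; rewrite -EFinB; congr EFin; lra.
have : (0 <= c%:E * \sum_i equot ((r i - d i) ^+ 2) (d i))%E.
  by apply: mule_ge0; [exact: c0|apply: sum_equot_ge0 => // i; exact: sqr_ge0].
move: II I4_fin I0 I30 I40 I50; move: (c%:E * _)%E I I3 I4 I5.
(* The signs and the finiteness of [I4] leave two possibilities: all values are real, or both sides
   are [+oo]. *)
case=> [x| |] [y| |] [z| |] [u| |] [v| |] //=.
move=> [II] _ _ _ _ _ _; rewrite -?EFinM -?EFinN -?EFinD; congr EFin; lra.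
Qed.

(** * Ordered spectra of density matrices, and the maximization *)

Lemma sort_nth_mono (R : realType) (leT : rel R) (s : seq R) (i j : nat) :
  transitive leT -> total leT -> (i <= j)%N -> (j < size s)%N ->
  leT (sort leT s)`_i (sort leT s)`_j.
Proof.
move=> tr tot ij js; have rf : reflexive leT by move=> x; have := tot x x; rewrite orbb.
by apply: (sorted_leq_nth tr rf 0 (sort_sorted tot s)) => //;
  rewrite inE size_sort // (leq_ltn_trans ij).
Qed.

Lemma size_eigs (R : realType) n (A : 'M[R[i]]_n) : size (eigs A) = n.
Proof. by rewrite size_map size_enum_ord. Qed.

Lemma udiag1 (R : realType) n (a : 'I_n -> R) :
  udiag 1%:M a = diag_mx (\row_i (a i)%:C).
Proof. by rewrite /udiag trmx1 map_mx1 mul1mx mulmx1. Qed.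

Lemma diagonalized_udiag (R : realType) n (A V : 'M[R[i]]_n) (a : 'I_n -> R) :
  V \is unitarymx -> V ^t* *m A *m V = udiag 1%:M a -> A = udiag (V ^t*) a.
Proof.
move=> /unitarymxP uV VAV.
have -> : A = (V ^t*) ^t* *m (V ^t* *m A *m V) *m V ^t*.
  by rewrite trmxCK !mulmxA uV mul1mx -mulmxA uV mulmx1.
by rewrite VAV udiag_adj mul1mx.
Qed.

Lemma eig_downP (R : realType) n (A V : 'M[R[i]]_n) :
  density A -> V \is unitarymx -> V ^t* *m A *m V = eig_down A ->
  exists r : 'I_n -> R,
  [/\ forall i j : 'I_n, (i <= j)%N -> r j <= r i, forall i, 0 <= r i,
      \sum_i r i = 1, A = udiag (V ^t*) r & eig_down A = udiag 1%:M r].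
Proof.
move=> [pA trA] uV VAV; pose r (i : 'I_n) := (sort >=%R (eigs A))`_i.
have dE : eig_down A = udiag 1%:M r by rewrite udiag1.
have uVt := unitarymxC uV.
have AE : A = udiag (V ^t*) r by apply: diagonalized_udiag uV _; rewrite VAV.
exists r; split=> //.
- move=> i j ij; apply: (@sort_nth_mono R >=%R) => //.
  + by move=> x y z yx /le_trans; apply.
  + by rewrite size_eigs ltn_ord.
- by apply/(psd_udiag _ uVt); rewrite -AE.
- by rewrite -(rtr_udiag r uVt) -AE /rtr trA.
Qed.

Lemma eig_upP (R : realType) n (A V : 'M[R[i]]_n) :
  density A -> V \is unitarymx -> V ^t* *m A *m V = eig_up A ->
  exists d : 'I_n -> R,
  [/\ forall i j : 'I_n, (i <= j)%N -> d i <= d j, forall i, 0 <= d i,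
      \sum_i d i = 1, A = udiag (V ^t*) d & eig_up A = udiag 1%:M d].
Proof.
move=> [pA trA] uV VAV; pose d (i : 'I_n) := (sort <=%R (eigs A))`_i.
have dE : eig_up A = udiag 1%:M d by rewrite udiag1.
have uVt := unitarymxC uV.
have AE : A = udiag (V ^t*) d by apply: diagonalized_udiag uV _; rewrite VAV.
exists d; split=> //.
- move=> i j ij; apply: (@sort_nth_mono R <=%R) => //.
  + exact: le_trans.
  + by rewrite size_eigs ltn_ord.
- by apply/(psd_udiag _ uVt); rewrite -AE.
- by rewrite -(rtr_udiag d uVt) -AE /rtr trA.
Qed.

Unset Implicit Arguments.

Theorem theorem3p2 (R : realType) (n : nat) (f : R -> R)
    (c : R) (lam : {measure set (measurableTypeR R) -> \bar R})
    (rho sigma V W : 'M[R[i]]_n) :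
  operator_convex f ->
  opconv_repr f c lam ->
  density rho -> density sigma ->
  V \is unitarymx -> W \is unitarymx ->
  V ^t* *m rho *m V = eig_down rho ->
  W ^t* *m sigma *m W = eig_up sigma ->
  let S (U : 'M[R[i]]_n) := maxdiv f rho (U ^t* *m sigma *m U) in
  is_max [set U | U \is unitarymx] S
    (maxdiv_diag f c lam (eig_down rho) (eig_up sigma))
  /\ argmax [set U | U \is unitarymx] S (W *m V ^t*).
Proof.
move=> _ fr rhoP sigmaP uV uW /(eig_downP rhoP uV) [r [r_dec r0 r1 rhoE ->]].
move=> /(eig_upP sigmaP uW) [d [d_inc d0 d1 sigmaE ->]] S.
have uVt := unitarymxC uV; have uWt := unitarymxC uW.
(* The unitary [U] enters only through the eigenbasis of the second state, which becomes
   [W ^t* *m U]. *)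
have SE U : U \is unitarymx -> S U = ((f 1)%:E + lim (shift_div c lam
    (udiag (V ^t*) r) (udiag (W ^t* *m U) d) e @[e --> 0^'+]))%E.
  move=> uU; have uWU := mul_unitarymx uWt uU.
  rewrite /S sigmaE rhoE udiag_adj; apply: (maxdiv_shift_div fr).
  - exact/(psd_udiag _ uVt).
  - exact/(psd_udiag _ uWU).
  - by rewrite (rtr_udiag _ uVt) r1.
  - by rewrite (rtr_udiag _ uWU) d1.
clearbody S; have rd : \sum_i r i = \sum_i d i by rewrite r1 d1.
set m := maxdiv_diag _ _ _ _ _.
(* The value of a commuting pair depends only on the two spectra, so the diagonal formula is also
   the limit in any common eigenbasis [T]. *)
have mE T : T \is unitarymx -> m = ((f 1)%:E + lim (shift_div c lam
    (udiag T r) (udiag T d) e @[e --> 0^'+]))%E.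
  move=> uT; rewrite (cvg_shift_div_comm fr uT r0 d0 rd).
  exact: (maxdiv_diag_udiag fr (unitarymx1 R n) r0 d0 r1 d1).
have opt_unitary := mul_unitarymx uW uVt.
(* For this unitary the second basis collapses to [V ^t*], so the states commute with oppositely
   ordered spectra. *)
have S_opt : S (W *m V ^t*) = m.
  rewrite (SE _ opt_unitary) mulmxA (unitarymxVl uW) mul1mx.
  by rewrite -(mE _ uVt).
have S_le U : U \is unitarymx -> (S U <= m)%E.
  move=> uU; have uWU := mul_unitarymx uWt uU.
  have psdT T (a : 'I_n -> R) : T \is unitarymx -> (forall i, 0 <= a i) ->
    psd (udiag T a) by move=> uT a0; apply/(psd_udiag _ uT).
  (* The bound holds for every positive [e] and passes to the limits, both of which exist by
     monotonicity. *)
  rewrite (SE _ uU) (mE _ uVt); apply: leeD2l; apply: lee_lim.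
  - apply: (shift_div_is_cvg fr); [exact: psdT|exact: psdT|].
    by rewrite (rtr_udiag _ uVt) (rtr_udiag _ uWU).
  - apply: (shift_div_is_cvg fr); [exact: psdT|exact: psdT|].
    by rewrite !(rtr_udiag _ uVt) rd.
  - near=> e.
    by apply: (shift_div_le fr uVt uWU uVt r_dec d_inc r0 d0 rd).
split; first by split; [exists (W *m V ^t*); [exact: opt_unitary|exact: S_opt]|exact: S_le].
split; first exact: opt_unitary.
by move=> U uU; rewrite S_opt; exact: S_le.
Unshelve. all: by end_near. Qed.
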